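(* Let $\mathcal X,\mathcal Y,f,L,L_0,\widehat L,V,q$ be as in the context, with $\widehat L>L$, and suppose the sampling (lower-mass) condition and the PL condition stated in the context hold. Let $N\ge1$, $V_N(x)=\max_{j\in[N]}q(x,y_j)$ and $\beta_N=\max_{y\in\mathcal Y}\min_{j\in[N]}\|y-y_j\|$. Let $$\mathcal D=\{x\in\mathcal X:0\in\partial V(x)+\mathcal N_{\mathcal X}(x)\},\qquad \mathcal D_N=\{x\in\mathcal X:0\in\partial V_N(x)+\mathcal N_{\mathcal X}(x)\}.$$ For any stationary point $x_N\in\mathcal D_N$, its distance to $\mathcal D$ is bounded by $$\operatorname{dist}(x_N,\mathcal D)\le\mathcal R_{\mathcal D}^{-1}\big(L_\kappa(x_N)\beta_N\big).$$ Consequently, $$d(\mathcal D_N,\mathcal D)\le\mathcal R_{\mathcal D}^{-1}\Big(\sup_{x\in\mathcal D_N}L_\kappa(x)\beta_N\Big).$$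
   Context: $\|\cdot\|$ is the Euclidean norm (operator norm for matrices), $[N]=\{1,\ldots,N\}$. $\mathcal X\subseteq\mathbb R^n$ and $\mathcal Y\subseteq\mathbb R^m$ are nonempty, compact, convex sets. $f$ is a real-valued function, twice continuously differentiable in an open neighborhood of $\mathcal X\times\mathcal Y$, and there are constants $L,L_0>0$ such that for all $(x,y),(x',y')\in\mathcal X\times\mathcal Y$: $\|\nabla f(x,y)-\nabla f(x',y')\|\le L\|(x,y)-(x',y')\|$ and $\|\nabla^2_{xy}f(x,y)-\nabla^2_{xy}f(x',y')\|\le L_0\|(x,y)-(x',y')\|$. Moreover $L$ is chosen large enough that also $\|\nabla f(x,y)\|\le L$ on $\mathcal X\times\mathcal Y$. $\widehat L>L$ is a fixed constant. Define $$V(x)=\max_{y\in\mathcal Y}f(x,y),\qquad q(x,y)=f(x,y)+\max_{z\in\mathcal Y}\Big(\langle\nabla_yf(x,y),z-y\rangle-\tfrac{\widehat L}{2}\|z-y\|^2\Big).$$ Sampling (lower-mass) condition: $y_1,y_2,\ldots$ are i.i.d. samples from a probability measure $P$ supported on $\mathcal Y$, $Y_N=\{y_1,\ldots,y_N\}$, and there are constants $C_0,\gamma,\delta_0>0$ with $P(\{y\in\mathcal Y:\|y-y_0\|\le\delta\})\ge C_0\delta^\gamma$ for all $y_0\in\mathcal Y$ and $\delta\in(0,\delta_0)$. PL condition: for any $x\in\mathcal X$ there is a constant $\kappa_p(x)>0$ such that for all $y\in\mathcal Y$, $\kappa_p(x)\big(V(x)-f(x,y)\big)\le\operatorname{dist}^2\big(0,-\nabla_yf(x,y)+\mathcal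 N_{\mathcal Y}(y)\big)$. For a closed convex set $\Omega$, $\mathcal N_\Omega(w)=\{\xi:\langle\xi,w'-w\rangle\le0\ \forall w'\in\Omega\}$. $D_{\mathcal Y}$ is the diameter of $\mathcal Y$. Define $$\kappa_q(x)=\frac{\kappa_p(x)(\widehat L-L)}{2\kappa_p(x)+8(\widehat L-L)},\qquad L_\kappa(x)=\Big(D_{\mathcal Y}L_0+\Big(3+\frac{L}{\widehat L}\Big)L\Big)\sqrt{\frac{\widehat L}{\kappa_q(x)}}.$$ $\partial$ denotes the Clarke subdifferential: $\partial h(\bar x)=\{z:\langle z,d\rangle\le\limsup_{x\to\bar x,t\downarrow0}(h(x+td)-h(x))/t\ \forall d\}$; $V,V_N$ are understood to be defined by the same formulas for $x$ in an open neighborhood of $\mathcal X$. $d(A,B)=\sup_{a\in A}\operatorname{dist}(a,B)$. Residual: $r(x)=\operatorname{dist}(0,\partial V(x)+\mathcal N_{\mathcal X}(x))$. Error-bound modulus: with $A_{\mathcal D}(\tau)=\{x\in\mathcal X:\operatorname{dist}(x,\mathcal D)\ge\tau\}$, $\mathcal R_{\mathcal D}(\tau)=\inf\{r(x):x\in A_{\mathcal D}(\tau)\}$ if $A_{\mathcal D}(\tau)\neq\emptyset$ and $+\infty$ otherwise; $\mathcal R_{\mathcal D}^{-1}(t)=\sup\{\tau\ge0:\mathcal R_{\mathcal D}(\tau)\le t\}$ for $t\ge0$, with $\mathcal R_{\mathcal D}^{-1}(+\infty)=+\infty$. The sets $\mathcal D$ and $\mathcal D_N$ are nonempty. *)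

(* Defs.v *)
From HB Require Import structures.
From mathcomp Require Import all_boot all_order all_algebra.
From mathcomp Require Import all_classical all_reals all_analysis.

Set Implicit Arguments.
Unset Strict Implicit.
Unset Printing Implicit Defensive.

Import Order.TTheory GRing.Theory Num.Theory.
Import numFieldNormedType.Exports.

Local Open Scope classical_set_scope.
Local Open Scope ring_scope.

(* The norm that the library puts on 'rV[R]_n is the sup norm.  It induces the
   usual topology, so the library's open, compact, differentiable, nbhs are used
   as they are, but all metric quantities below are Euclidean. *)
Section Euclidean.
Context {R : realType}.

Definition dotv n (u v : 'rV[R]_n) : R := \sum_(i < n) u 0 i * v 0 i.

Definition enorm n (u : 'rV[R]_n) : R := Num.sqrt (dotv u u).

(* Row vectors are acted on from the right; the operator norm is invariant
   under transposition. *)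
Definition opnorm n m (A : 'M[R]_(n, m)) : R :=
  sup [set enorm (u *m A) | u in [set u : 'rV[R]_n | enorm u <= 1]].

Definition diameter n (A : set 'rV[R]_n) : R :=
  sup [set enorm (u - v) | u in A & v in A].

(* Extended-real valued; equal to +oo when A is empty. *)
Definition dist n (u : 'rV[R]_n) (A : set 'rV[R]_n) : \bar R :=
  ereal_inf [set (enorm (u - a))%:E | a in A].

Definition excess n (A B : set 'rV[R]_n) : \bar R :=
  ereal_sup [set dist a B | a in A].

Definition addset n (A B : set 'rV[R]_n) : set 'rV[R]_n :=
  [set a + b | a in A & b in B].

Definition normal_cone n (A : set 'rV[R]_n) (w : 'rV[R]_n) : set 'rV[R]_n :=
  [set xi | forall w', A w' -> dotv xi (w' - w) <= 0].

(* The upper limit ranges over all (x, t) with x near xbar (x = xbar allowed)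
   and t > 0 near 0. *)
Definition clarke_subdiff n (h : 'rV[R]_n -> R) (xbar : 'rV[R]_n) :
    set 'rV[R]_n :=
  [set z | forall v : 'rV[R]_n,
     ((dotv z v)%:E <=
       limf_esup (fun p : 'rV[R]_n * R =>
                    ((h (p.1 + p.2 *: v) - h p.1) / p.2)%:E)
                 (filter_prod (nbhs xbar) (0 : R)^'+))%E].

End Euclidean.

Section Calculus.
Context {R : realType}.

Definition grad k (F : 'rV[R]_k -> R) (p : 'rV[R]_k) : 'rV[R]_k :=
  \row_(i < k) 'D_(delta_mx 0 i) F p.

(* Entry (i, j) is the derivative along the i-th coordinate of the j-th partial
   derivative of F. *)
Definition hess k (F : 'rV[R]_k -> R) (p : 'rV[R]_k) : 'M[R]_k :=
  jacobian (grad F) p.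

Definition C2_on k (U : set 'rV[R]_k) (F : 'rV[R]_k -> R) : Prop :=
  forall p, U p -> [/\ differentiable F p, differentiable (grad F) p &
                       {for p, continuous (hess F)}].

End Calculus.

(* A function f(x, y) on R^n x R^m is a function on R^(n + m), the pair (x, y)
   being the row vector row_mx x y, whose enorm is the Euclidean norm of the
   pair. *)
Section Minimax.
Context {R : realType} {n m : nat}.
Implicit Types (X : set 'rV[R]_n) (Y : set 'rV[R]_m) (f : 'rV[R]_(n + m) -> R)
  (x : 'rV[R]_n) (y : 'rV[R]_m).

Definition prodset X Y : set 'rV[R]_(n + m) :=
  [set row_mx x y | x in X & y in Y].

Definition grad_y f x y : 'rV[R]_m := rsubmx (grad f (row_mx x y)).

Definition hess_xy f (p : 'rV[R]_(n + m)) : 'M[R]_(n, m) := ursubmx (hess f p).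

(* The maxima defining V, q, V_N and beta_N are written as suprema in R; for V
   and q they are attained for x near X (resp. (x, y) near X x Y), which is all
   that the Clarke subdifferentials at points of X depend on. *)
Definition Vmax Y f x : R := sup [set f (row_mx x y) | y in Y].

Definition qfun Y f (Lhat : R) x y : R :=
  f (row_mx x y) +
  sup [set dotv (grad_y f x y) (z - y) - Lhat / 2 * enorm (z - y) ^+ 2
      | z in Y].

(* The samples y_1, ..., y_N are s 0, ..., s (N - 1). *)
Definition VNmax Y f (Lhat : R) (N : nat) (s : nat -> 'rV[R]_m) x : R :=
  sup [set qfun Y f Lhat x (s j) | j in [set j | (j < N)%N]].

Definition betaN Y (N : nat) (s : nat -> 'rV[R]_m) : R :=
  sup [set inf [set enorm (y - s j) | j in [set j | (j < N)%N]] | y in Y].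

Definition smoothness_assumption X Y f (L L0 : R) : Prop :=
  [/\ exists2 U, open U & prodset X Y `<=` U /\ C2_on U f,
      forall p p', prodset X Y p -> prodset X Y p' ->
        enorm (grad f p - grad f p') <= L * enorm (p - p'),
      forall p p', prodset X Y p -> prodset X Y p' ->
        opnorm (hess_xy f p - hess_xy f p') <= L0 * enorm (p - p') &
      forall p, prodset X Y p -> enorm (grad f p) <= L].

Definition PL_condition X Y f (kappa_p : 'rV[R]_n -> R) : Prop :=
  forall x, X x -> 0 < kappa_p x /\
    forall y, Y y ->
      ((kappa_p x * (Vmax Y f x - f (row_mx x y)))%:E <=
       dist 0%R (addset [set (- grad_y f x y)%R] (normal_cone Y y)) ^+ 2)%E.

Definition kappa_q (kappa_p : 'rV[R]_n -> R) (L Lhat : R) x : R :=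
  kappa_p x * (Lhat - L) / (2 * kappa_p x + 8 * (Lhat - L)).

Definition Lkappa Y (kappa_p : 'rV[R]_n -> R) (L L0 Lhat : R) x : R :=
  (diameter Y * L0 + (3 + L / Lhat) * L)
  * Num.sqrt (Lhat / kappa_q kappa_p L Lhat x).

End Minimax.

Section Stationarity.
Context {R : realType} {n : nat}.
Implicit Types (X D : set 'rV[R]_n) (h V : 'rV[R]_n -> R) (x : 'rV[R]_n).

Definition stationary_map X h x : set 'rV[R]_n :=
  addset (clarke_subdiff h x) (normal_cone X x).

Definition stationary X h : set 'rV[R]_n :=
  [set x | X x /\ stationary_map X h x 0].

Definition residual X V x : \bar R := dist 0 (stationary_map X V x).

(* The infimum over the empty set is +oo. *)
Definition eb_modulus X V D (tau : R) : \bar R :=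
  ereal_inf [set residual X V x | x in [set x | X x /\ (tau%:E <= dist x D)%E]].

(* Meant for 0 <= t. *)
Definition eb_modulus_inv X V D (t : \bar R) : \bar R :=
  if t == +oo%E then +oo%E
  else ereal_sup [set tau%:E | tau in
                    [set tau : R | 0 <= tau /\ (eb_modulus X V D tau <= t)%E]].

End Stationarity.

(* R^m with its Borel sigma-algebra. *)
Notation borel_rV R m := (g_sigma_algebraType (@open 'rV[R]_m)).

Section Sampling.
Context {R : realType} {m : nat} {d : measure_display} {Omega : measurableType d}.

Definition iid (Pr : probability Omega R) (P : probability (borel_rV R m) R)
    (s : nat -> {RV Pr >-> borel_rV R m}) : Prop :=
  (forall j A, measurable A -> distribution Pr (s j) A = P A) /\
  (forall (J : seq nat) (A : nat -> set (borel_rV R m)), uniq J ->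
     (forall j, measurable (A j)) ->
     Pr (\bigcap_(j in [set` J]) s j @^-1` A j) =
     (\prod_(j <- J) Pr (s j @^-1` A j))%E).

Definition lower_mass (Y : set 'rV[R]_m) (P : probability (borel_rV R m) R)
    (C0 gamma delta0 : R) : Prop :=
  [/\ 0 < C0, 0 < gamma, 0 < delta0 &
      forall (y0 : 'rV[R]_m) (delta : R), Y y0 -> 0 < delta < delta0 ->
        ((C0 * delta `^ gamma)%:E <=
         P [set y : 'rV[R]_m | Y y /\ (enorm (y - y0) <= delta)%R])%E].

End Sampling.

(* Main.v *)
(** Let 0 = g + xi with g in the Clarke subdifferential of V_N at x and xi
    normal to X.  It suffices to find g' in the subdifferential of V at x with
    |g - g'| <= L_kappa(x) beta: then r(x) <= |g' + xi| = |g - g'|, and the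
    definition of the inverse modulus gives the distance bound.
    (1) PL implies (kappa_p / 4) dist(y, S)^2 <= V - f(x, y), where S is the
    set of maximisers of f(x, .).  Applied at the proximal point of y this gives
    kappa_q dist(y, S)^2 <= V - q(x, y).  As V - V_N <= Lhat beta^2, each active
    sample y_j lies within sqrt(Lhat / kappa_q) beta of some ys in S.
    (2) The difference quotients of q(., y_j) near x in the direction v are at
    most <grad_x f(x, y_j), v> + <H (z - y_j), v> + o(1), with H the mixed second
    derivative at (x, y_j) and z a proximal point.  By the symmetry of second
    derivatives and the Lipschitz bound on the gradient this is at most
    <grad_x f(x, ys), v> + (3 + L / Lhat) L |y_j - ys| |v| + o(1).
    (3) All grad_x f(x, ys) lie in the subdifferential of V; projecting g onto
    the part of it in the ball of radius L and taking v = g - g' concludes. *)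
Require Import Defs.
From HB Require Import structures.
From mathcomp Require Import all_boot all_order all_algebra.
From mathcomp Require Import all_classical all_reals all_analysis.
From mathcomp Require Import ring lra.

Import Order.TTheory GRing.Theory Num.Theory.
Import numFieldNormedType.Exports.

Local Open Scope classical_set_scope.
Local Open Scope ring_scope.

Set Implicit Arguments.
Unset Strict Implicit.

(** * Euclidean norm *)

Section EuclideanTheory.
Context {R : realType}.
Implicit Types (n m : nat) (a c : R).

Lemma dotvC n (u v : 'rV[R]_n) : dotv u v = dotv v u.
Proof. by apply: eq_bigr => i _; rewrite mulrC. Qed.

Lemma dotvDl n (u v w : 'rV[R]_n) : dotv (u + v) w = dotv u w + dotv v w.
Proof. by rewrite -big_split; apply: eq_bigr => i _; rewrite mxE mulrDl. Qed.

Lemma dotvZl n a (u v : 'rV[R]_n) : dotv (a *: u) v = a * dotv u v.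
Proof. by rewrite mulr_sumr; apply: eq_bigr => i _; rewrite mxE mulrA. Qed.

Lemma dotvNl n (u v : 'rV[R]_n) : dotv (- u) v = - dotv u v.
Proof. by rewrite -scaleN1r dotvZl mulN1r. Qed.

Lemma dotvBl n (u v w : 'rV[R]_n) : dotv (u - v) w = dotv u w - dotv v w.
Proof. by rewrite dotvDl dotvNl. Qed.

Lemma dotvDr n (u v w : 'rV[R]_n) : dotv u (v + w) = dotv u v + dotv u w.
Proof. by rewrite dotvC dotvDl ![dotv _ u]dotvC. Qed.

Lemma dotvZr n a (u v : 'rV[R]_n) : dotv u (a *: v) = a * dotv u v.
Proof. by rewrite dotvC dotvZl dotvC. Qed.

Lemma dotvNr n (u v : 'rV[R]_n) : dotv u (- v) = - dotv u v.
Proof. by rewrite dotvC dotvNl dotvC. Qed.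

Lemma dotv0r n (u : 'rV[R]_n) : dotv u 0 = 0.
Proof. by rewrite -[X in dotv u X](scale0r 0) dotvZr mul0r. Qed.

Definition dotvE := (dotvDl, dotvDr, dotvNl, dotvNr, dotvZl, dotvZr).

Lemma dotvv_ge0 n (u : 'rV[R]_n) : 0 <= dotv u u.
Proof. by apply: sumr_ge0 => i _; rewrite -expr2 sqr_ge0. Qed.

Lemma enorm_ge0 n (u : 'rV[R]_n) : 0 <= enorm u.
Proof. exact: sqrtr_ge0. Qed.

Lemma sqr_enorm n (u : 'rV[R]_n) : enorm u ^+ 2 = dotv u u.
Proof. by rewrite sqr_sqrtr ?dotvv_ge0. Qed.

Lemma enorm_leP n (u : 'rV[R]_n) c : 0 <= c -> dotv u u <= c ^+ 2 -> enorm u <= c.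
Proof. by move=> c0 h; rewrite -(@ler_pXn2r _ 2) ?nnegrE ?enorm_ge0// sqr_enorm. Qed.

Lemma enorm0 n : enorm (0 : 'rV[R]_n) = 0.
Proof. by rewrite /enorm dotv0r sqrtr0. Qed.

Arguments enorm0 n : clear implicits.

Lemma enormZ n a (u : 'rV[R]_n) : enorm (a *: u) = `|a| * enorm u.
Proof. by rewrite /enorm !dotvE mulrA -expr2 sqrtrM ?sqr_ge0// sqrtr_sqr. Qed.

Lemma enormN n (u : 'rV[R]_n) : enorm (- u) = enorm u.
Proof. by rewrite /enorm dotvNl dotvNr opprK. Qed.

Lemma enormB n (u v : 'rV[R]_n) : enorm (u - v) = enorm (v - u).
Proof. by rewrite -enormN opprB. Qed.

(** Cauchy-Schwarz, by expanding the squared norm of [enorm v *: u - enorm u *: v]; zero vectors are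
    treated apart because the norms are cancelled at the end. *)
Lemma dotv_le n (u v : 'rV[R]_n) : dotv u v <= enorm u * enorm v.
Proof.
have [u0|u0] := eqVneq (enorm u) 0.
  rewrite u0 mul0r; have uu : dotv u u = 0 by rewrite -sqr_enorm u0 expr0n.
  suff -> : u = 0 by rewrite dotvC dotv0r.
  apply/rowP => i; rewrite mxE; apply/eqP; rewrite -sqrf_eq0 expr2.
  by have /psumr_eq0P -> // := uu => j _; rewrite -expr2 sqr_ge0.
have h := dotvv_ge0 (enorm v *: u - enorm u *: v).
have /(mulr_ge0 (enorm_ge0 v)) {}h : 0 <= enorm u * (enorm u * enorm v - dotv u v) * 2 * enorm v.
  move: h; rewrite !dotvE -!sqr_enorm (dotvC v u); nra.
have u1 : 0 < enorm u by rewrite lt_def u0 enorm_ge0.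
have [v0|v0] := eqVneq (enorm v) 0.
  rewrite v0 mulr0; have vv : dotv v v = 0 by rewrite -sqr_enorm v0 expr0n.
  suff -> : v = 0 by rewrite dotv0r.
  apply/rowP => i; rewrite mxE; apply/eqP; rewrite -sqrf_eq0 expr2.
  by have /psumr_eq0P -> // := vv => j _; rewrite -expr2 sqr_ge0.
have v1 : 0 < enorm v by rewrite lt_def v0 enorm_ge0.
rewrite -subr_ge0 -(pmulr_lge0 _ (mulr_gt0 u1 (mulr_gt0 v1 v1))).
move: h; nra.
Qed.

Lemma normr_dotv_le n (u v : 'rV[R]_n) : `|dotv u v| <= enorm u * enorm v.
Proof.
rewrite ler_norml dotv_le andbT lerNl -dotvNl.
by rewrite -[enorm u]enormN dotv_le.
Qed.

Lemma enormD n (u v : 'rV[R]_n) : enorm (u + v) <= enorm u + enorm v.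
Proof.
apply: enorm_leP; first by rewrite addr_ge0 ?enorm_ge0.
rewrite !dotvE (dotvC v u) sqrrD !sqr_enorm; have := dotv_le u v; nra.
Qed.

Lemma enorm_triangle n (v u w : 'rV[R]_n) :
  enorm (u - w) <= enorm (u - v) + enorm (v - w).
Proof. by apply: le_trans (enormD _ _); rewrite addrA subrK. Qed.

Lemma coord_le_enorm n (u : 'rV[R]_n) i : `|u 0 i| <= enorm u.
Proof.
rewrite -sqrtr_sqr ler_wsqrtr// /dotv (bigD1 i)//= expr2 lerDl.
by apply: sumr_ge0 => j _; rewrite -expr2 sqr_ge0.
Qed.

Lemma mx_norm_le_enorm n (u : 'rV[R]_n) : `|u| <= enorm u.
Proof.
rewrite [leLHS]mx_normrE; apply/bigmax_leP; split; first exact: enorm_ge0.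
by move=> [i j] _ /=; rewrite ord1 coord_le_enorm.
Qed.

Lemma continuous_dotvl n (v : 'rV[R]_n) : continuous (fun u => dotv u v).
Proof.
apply: continuous_big => [|i _]; first exact: add_continuous.
move=> u; apply: (@continuousM _ _ (fun u : 'rV[R]_n => u 0 i) (cst (v 0 i))).
  exact: coord_continuous.
exact: cst_continuous.
Qed.

Lemma continuous_dotvr n (v : 'rV[R]_n) : continuous (fun u => dotv v u).
Proof.
rewrite (_ : (fun u => _) = (fun u => dotv u v)); first exact: continuous_dotvl.
by apply/funext => u; rewrite dotvC.
Qed.

Lemma continuous_enorm n : continuous (@enorm R n).
Proof.
move=> u; apply: (@continuous_comp _ _ _ (fun u : 'rV[R]_n => dotv u u)).
  move: u; apply: continuous_big => [|i _]; first exact: add_continuous.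
  move=> u; apply: (@continuousM _ _ (fun u : 'rV[R]_n => u 0 i) (fun u => u 0 i));
    exact: coord_continuous.
exact: sqrt_continuous.
Qed.

Lemma continuous_enormB n (v : 'rV[R]_n) : continuous (fun u : 'rV[R]_n => enorm (u - v)).
Proof.
move=> u; apply: (@continuous_comp _ _ _ (fun u : 'rV[R]_n => u - v) (@enorm R n)).
  by apply: continuousB => //; exact: cst_continuous.
exact: continuous_enorm.
Qed.

Lemma continuous_sqr_enorm n (v : 'rV[R]_n) :
  continuous (fun u : 'rV[R]_n => enorm (u - v) ^+ 2).
Proof.
move=> u; apply: (@continuous_comp _ _ _ (fun u : 'rV[R]_n => enorm (u - v)) (fun r => r ^+ 2)).
  exact: continuous_enormB.
exact: exprn_continuous.
Qed.

Lemma dotv_row_mx n m (a1 b1 : 'rV[R]_n) (a2 b2 : 'rV[R]_m) :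
  dotv (row_mx a1 a2) (row_mx b1 b2) = dotv a1 b1 + dotv a2 b2.
Proof.
rewrite /dotv big_split_ord/=; congr (_ + _); apply: eq_bigr => i _.
  by rewrite !row_mxEl.
by rewrite !row_mxEr.
Qed.

Lemma dotv_row_mx0 n m (p : 'rV[R]_(n + m)) (v : 'rV[R]_n) :
  dotv p (row_mx v 0) = dotv (lsubmx p) v.
Proof. by rewrite -{1}(hsubmxK p) dotv_row_mx dotv0r addr0. Qed.

Lemma dotv_row_0mx n m (p : 'rV[R]_(n + m)) (w : 'rV[R]_m) :
  dotv p (row_mx 0 w) = dotv (rsubmx p) w.
Proof. by rewrite -{1}(hsubmxK p) dotv_row_mx dotv0r add0r. Qed.

Lemma enorm_row_mx0 n m (v : 'rV[R]_n) : enorm (row_mx v (0 : 'rV[R]_m)) = enorm v.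
Proof. by rewrite /enorm dotv_row_mx dotv0r addr0. Qed.

Lemma enorm_row_0mx n m (w : 'rV[R]_m) : enorm (row_mx (0 : 'rV[R]_n) w) = enorm w.
Proof. by rewrite /enorm dotv_row_mx dotv0r add0r. Qed.

Lemma enorm_lsubmx n m (p : 'rV[R]_(n + m)) : enorm (lsubmx p) <= enorm p.
Proof. by rewrite -{2}(hsubmxK p) /enorm ler_wsqrtr// dotv_row_mx lerDl dotvv_ge0. Qed.

Lemma enorm_rsubmx n m (p : 'rV[R]_(n + m)) : enorm (rsubmx p) <= enorm p.
Proof. by rewrite -{2}(hsubmxK p) /enorm ler_wsqrtr// dotv_row_mx lerDr dotvv_ge0. Qed.

Lemma enorm_bounded n (A : set 'rV[R]_n) : compact A ->
  exists M, forall u, A u -> enorm u <= M.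
Proof.
move=> cA; have [A0|/set0P A0] := eqVneq A set0.
  by exists 0 => u; rewrite A0.
have ce : {within A, continuous (@enorm R n)}.
  by apply: continuous_subspaceT => u; exact: continuous_enorm.
have [c _ hc] := compact_EVT_max A0 cA ce.
by exists (enorm c) => u Au; apply: hc; rewrite inE.
Qed.

Lemma le_diameter n (A : set 'rV[R]_n) u v : compact A -> A u -> A v ->
  enorm (u - v) <= diameter A.
Proof.
move=> /enorm_bounded[M hM] Au Av; apply: ub_le_sup; last by exists u => //; exists v.
exists (M + M) => _ [u' Au' [v' Av' <-]].
by rewrite (le_trans (enormD _ _))// enormN lerD// hM.
Qed.

Lemma diameter_ge0 n (A : set 'rV[R]_n) : compact A -> A !=set0 -> 0 <= diameter A.
Proof. by move=> cA [u Au]; apply: le_trans (le_diameter cA Au Au); exact: enorm_ge0. Qed.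

Lemma convex_set_segment n (A : set 'rV[R]_n) u v t : convex_set A -> A u -> A v ->
  0 <= t <= 1 -> A (u + t *: (v - u)).
Proof.
move=> cA Au Av /andP[t0 t1].
have t'1 : 0 <= 1 - t by rewrite subr_ge0.
have t'2 : 1 - t <= 1 by rewrite lerBlDr lerDl.
pose k : {i01 R} := Itv01 t'1 t'2.
have := cA u v k; rewrite !inE => /(_ Au Av).
suff E : (1 - t) *: u + (1 - (1 - t)) *: v = u + t *: (v - u) by rewrite -E.
by rewrite opprB addrCA subrr addr0 scalerBl scalerBr scale1r -addrA (addrC (- _)).
Qed.

End EuclideanTheory.

(** * Second-order calculus *)

Section SecondOrderCalculus.
Context {R : realType}.
Implicit Types (k : nat).

Lemma mvt01 (phi dphi : R -> R) :
  (forall s : R, 0 <= s <= 1 -> is_derive s 1 phi (dphi s)) ->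
  exists2 c, 0 <= c <= 1 & phi 1 - phi 0 = dphi c.
Proof.
move=> dphiE.
have [||c] := @MVT_segment R phi dphi 0 1 ler01.
- by move=> s /itvP s01; apply: dphiE; rewrite !s01.
- apply: derivable_within_continuous => s /itvP s01.
  by have [] := dphiE s; rewrite ?s01.
by move=> /itvP c01 ->; exists c; rewrite ?c01// subr0 mulr1.
Qed.

(** The mean value theorem applied to [phi] minus its quadratic model, whose derivative [dpsi] is at
    most 0. The bound is one-sided so that it serves [phi] and [- phi] in turn. *)
Lemma descent01 (phi dphi : R -> R) (K : R) :
  (forall s : R, 0 <= s <= 1 -> is_derive s 1 phi (dphi s)) ->
  (forall s : R, 0 <= s <= 1 -> dphi s - dphi 0 <= K * s) ->
  phi 1 - phi 0 - dphi 0 <= K / 2.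
Proof.
move=> dphiE hK.
pose psi (s : R) := phi s - (dphi 0 * s + K / 2 * (s * s)).
pose dpsi (s : R) := dphi s - dphi 0 - K * s.
have dpsiE (s : R) : 0 <= s <= 1 -> is_derive s 1 psi (dpsi s).
  move=> /dphiE ds; have -> : dpsi s = dphi s - (dphi 0 *: 1 + K / 2 *: (s *: 1 + s *: 1)).
    by rewrite /dpsi /GRing.scale/=; field.
  by apply: is_deriveB.
have [c c01] := mvt01 dpsiE.
have := hK c c01; rewrite /psi /dpsi; lra.
Qed.

Lemma is_derive_line k (F : 'rV[R]_k -> R) p v (s : R) :
  differentiable F (p + s *: v) ->
  is_derive s 1 (fun s => F (p + s *: v)) ('d F (p + s *: v) v).
Proof.
move=> dF; rewrite -deriveE//.
have E : (fun h : R => h^-1 *: ((F (p + (h *: 1 + s) *: v)) - F (p + s *: v)))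
       = (fun h => h^-1 *: ((F \o shift (p + s *: v)) (h *: v) - F (p + s *: v))).
  apply/funext => h /=; congr (_ *: (F _ - _)).
  by rewrite [h *: 1]mulr1 scalerDl addrCA addrC.
split; last by rewrite /derive /=; under eq_fun do rewrite /=; rewrite -E.
have := @diff_derivable _ _ _ F (p + s *: v) v dF.
by rewrite /derivable /= -E.
Qed.

Lemma diff_dotv_grad k (F : 'rV[R]_k -> R) p v :
  differentiable F p -> 'd F p v = dotv (grad F p) v.
Proof.
move=> dF; rewrite {1}(row_sum_delta v) linear_sum/=; apply: eq_bigr => i _.
by rewrite linearZ/= mxE deriveE// /GRing.scale/= mulrC.
Qed.

Lemma diff_linear_comp (V W Z : normedModType R) (l : {linear W -> Z})
    (G : V -> W) q v : continuous l -> differentiable G q ->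
  'd (l \o G) q v = l ('D_v G q).
Proof.
move=> cl dG; rewrite deriveE// diff_comp//; last exact: linear_differentiable.
by rewrite /= diff_lin.
Qed.

Lemma is_derive_dotv_line k (G : 'rV[R]_k -> 'rV[R]_k) p v w (s : R) :
  differentiable G (p + s *: v) ->
  is_derive s 1 (fun s => dotv (G (p + s *: v)) w)
    (dotv (v *m jacobian G (p + s *: v)) w).
Proof.
move=> dG.
have lin : linear (fun u : 'rV[R]_k => dotv u w : R^o).
  by move=> a x y; rewrite dotvDl dotvZl.
pose lM := GRing.isLinear.Build _ _ _ _ _ lin.
pose l : {linear 'rV[R]_k -> R^o} := HB.pack (fun u : 'rV[R]_k => dotv u w) lM.
have cl : continuous l by exact: continuous_dotvl.
have dl q : differentiable l q by exact: linear_differentiable.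
have E := diff_linear_comp v cl dG.
rewrite deriveEjacobian// in E.
have := @is_derive_line k (l \o G) p v s (differentiable_comp dG (dl _)).
by rewrite E.
Qed.

Lemma continuous_enorm_mulmx k (u c : 'rV[R]_k) :
  continuous (fun M : 'M[R]_k => enorm (u *m M - c)).
Proof.
move=> M0.
apply: (@continuous_comp _ _ _ (fun M : 'M[R]_k => dotv (u *m M - c) (u *m M - c))); last exact: sqrt_continuous.
have ce j : continuous (fun M : 'M[R]_k => (u *m M - c) 0 j).
  move=> M; under eq_fun do rewrite !mxE.
  apply: (@continuousB _ R^o _ (fun M : 'M[R]_k => \sum_i u 0 i * M i j) (cst (c 0 j))); last exact: cst_continuous.
  move: M; apply: continuous_big => [|i _]; first exact: add_continuous.
  move=> M; apply: (@continuousM _ _ (cst (u 0 i)) (fun M : 'M[R]_k => M i j)).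
    exact: cst_continuous.
  exact: coord_continuous.
move: M0; apply: continuous_big => [|j _]; first exact: add_continuous.
by move=> M; apply: (@continuousM _ _ (fun M : 'M[R]_k => (u *m M - c) 0 j) (fun M : 'M[R]_k => (u *m M - c) 0 j)); exact: ce.
Qed.

Lemma cvg_mulmx_enorm k (T : topologicalType) (H : T -> 'M[R]_k) p v (e : R) :
  {for p, continuous H} -> 0 < e ->
  \forall q \near p, enorm (v *m H q - v *m H p) <= e.
Proof.
move=> cH e0.
have := continuous_comp cH (@continuous_enorm_mulmx k v (v *m H p) (H p)).
move=> /cvgrPdist_le /(_ e e0); apply: filterS => q /=.
by rewrite (subrr (v *m H p)) enorm0 sub0r normrN ger0_norm ?enorm_ge0.
Qed.

Lemma hess_near k (U : set 'rV[R]_k) (F : 'rV[R]_k -> R) p v (e : R) :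
  open U -> C2_on U F -> U p -> 0 < e ->
  \forall q \near p, U q /\ enorm (v *m hess F q - v *m hess F p) <= e.
Proof.
move=> oU F2 Up e0.
apply: filterI; first exact: open_nbhs_nbhs.
by have [_ _ ch] := F2 p Up; exact: (cvg_mulmx_enorm v ch e0).
Qed.

Lemma nbhs_parallelogram k (A : set 'rV[R]_k) (p u v : 'rV[R]_k) : nbhs p A ->
  exists2 t : R, 0 < t & forall a b, 0 <= a <= t -> 0 <= b <= t ->
    A (p + a *: u + b *: v).
Proof.
move=> /nbhs_ballP[e /= e0 eA].
have d0 : 0 < `|u| + `|v| + 1 by rewrite ltr_wpDl// addr_ge0.
exists (e / 2 / (`|u| + `|v| + 1)); first by rewrite !divr_gt0.
move=> a b /andP[a0 at_] /andP[b0 bt]; apply: eA.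
rewrite -ball_normE /= -addrA opprD addNKr normrN.
rewrite (le_lt_trans (ler_normD _ _))// !normrZ !ger0_norm//.
set t := e / 2 / _ in at_ bt.
have tE : t * (`|u| + `|v| + 1) = e / 2 by rewrite /t divfK// gt_eqF.
have h1 : a * `|u| <= t * `|u| by rewrite ler_wpM2r.
have h2 : b * `|v| <= t * `|v| by rewrite ler_wpM2r.
have t0 : 0 < t by rewrite !divr_gt0.
lra.
Qed.

(** Two applications of the mean value theorem: along [u] to the increment of [F] in the direction
    [v], then along [v] to the derivative of [F] in the direction [u]. *)
Lemma second_difference k (U : set 'rV[R]_k) (F : 'rV[R]_k -> R) p u v (t : R) :
  C2_on U F -> 0 < t ->
  (forall a b, 0 <= a <= t -> 0 <= b <= t -> U (p + a *: u + b *: v)) ->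
  exists a b, [/\ 0 <= a <= t, 0 <= b <= t &
    F (p + t *: u + t *: v) - F (p + t *: u) - (F (p + t *: v) - F p)
    = t ^+ 2 * dotv (v *m hess F (p + a *: u + b *: v)) u].
Proof.
move=> F2 t0 inU.
have tt : 0 <= t <= t by rewrite ltW/=.
have t00 : 0 <= (0 : R) <= t by rewrite lexx ltW.
have ts (s : R) : 0 <= s <= 1 -> 0 <= s * t <= t.
  by move=> /andP[s0 s1]; rewrite mulr_ge0 ?(ltW t0)//= ler_piMl ?(ltW t0).
pose phi (s : R) := F (p + t *: v + s *: (t *: u)) - F (p + s *: (t *: u)).
pose dphi (s : R) := dotv (grad F (p + t *: v + s *: (t *: u))) (t *: u)
  - dotv (grad F (p + s *: (t *: u))) (t *: u).
have [s /ts s01|c c01] := @mvt01 phi dphi.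
  have [U1 U2] : U (p + t *: v + s *: (t *: u)) /\ U (p + s *: (t *: u)).
    split; rewrite scalerA; first by rewrite addrAC; exact: inU.
    by have := inU _ _ s01 t00; rewrite scale0r addr0.
  have [d1 _ _] := F2 _ U1; have [d2 _ _] := F2 _ U2.
  rewrite /dphi -!diff_dotv_grad//.
  by apply: is_deriveB; exact: is_derive_line.
rewrite /phi !scale0r !scale1r !addr0 (addrAC p (t *: u)) => ->; rewrite /dphi scalerA.
have [s /ts s01|b b01] := @mvt01
  (fun s => dotv (grad F (p + (c * t) *: u + s *: (t *: v))) (t *: u))
  (fun s => dotv ((t *: v) *m jacobian (grad F) (p + (c * t) *: u + s *: (t *: v))) (t *: u)).
  apply: is_derive_dotv_line.
  have U1 : U (p + (c * t) *: u + s *: (t *: v)).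
    by rewrite scalerA; apply: inU => //; exact: ts.
  by have [] := F2 _ U1.
rewrite !scale0r scale1r !addr0 -addrAC => ->.
exists (c * t), (b * t); split; [exact: ts|exact: ts|].
rewrite -(scalerA b t v) /hess.
move: (jacobian _ _) => M.
by rewrite -scalemxAl dotvZl dotvZr mulrA -expr2.
Qed.

(** The second difference over a small parallelogram does not depend on the order of its sides, so
    the two mixed forms agree when taken at two suitable nearby points; continuity of the Hessian
    brings both points to [p]. *)
Lemma schwarz_symmetry k (U : set 'rV[R]_k) (F : 'rV[R]_k -> R) p u v :
  open U -> C2_on U F -> U p ->
  dotv (u *m hess F p) v = dotv (v *m hess F p) u.
Proof.
move=> oU F2 Up; apply/eqP; rewrite -subr_eq0 -normr_le0; apply/ler_addgt0Pl => e e0.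
rewrite addr0.
pose d := e / (enorm u + enorm v + 1).
have D0 : 0 < enorm u + enorm v + 1 by rewrite ltr_wpDl// addr_ge0 ?enorm_ge0.
have d0 : 0 < d by rewrite divr_gt0.
have dE : d * (enorm u + enorm v + 1) = e by rewrite /d divfK// gt_eqF.
have [t t0 ht] := nbhs_parallelogram u v
  (filterI (hess_near u oU F2 Up d0) (hess_near v oU F2 Up d0)).
have [|a [b [ha hb E1]]] := @second_difference k U F p u v t F2 t0.
  by move=> a b ha hb; have [[]] := ht a b ha hb.
have [|b' [a' [hb' ha' E2]]] := @second_difference k U F p v u t F2 t0.
  by move=> b' a' hb' ha'; have [[]] := ht a' b' ha' hb'; rewrite addrAC.
have E : dotv (v *m hess F (p + a *: u + b *: v)) u =
         dotv (u *m hess F (p + a' *: u + b' *: v)) v.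
  have t2 : t ^+ 2 != 0 by rewrite sqrf_eq0 gt_eqF.
  apply: (mulfI t2); rewrite -E1 (addrAC p _ (b' *: v)) -E2 (addrAC p (t *: v)); ring.
have [_ [_ n1]] := ht a b ha hb; have [[_ n2] _] := ht a' b' ha' hb'.
set h1 := hess F (p + a *: u + b *: v) in E n1.
set h2 := hess F (p + a' *: u + b' *: v) in E n2.
clear E1 E2 ht; move: (hess F p) n1 n2 => h0; clearbody h1 h2 => n1 n2.
have := normr_dotv_le (v *m h1 - v *m h0) u.
have := normr_dotv_le (u *m h2 - u *m h0) v.
rewrite !dotvBl E !ler_norml => /andP[p1 p2] /andP[p3 p4].
have q1 : enorm (v *m h1 - v *m h0) * enorm u <= d * enorm u.
  by rewrite ler_wpM2r ?enorm_ge0.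
have q2 : enorm (u *m h2 - u *m h0) * enorm v <= d * enorm v.
  by rewrite ler_wpM2r ?enorm_ge0.
lra.
Qed.

End SecondOrderCalculus.

(** * Quadratic growth from the PL inequality *)

Section ProxMap.
Context {R : realType} {m : nat}.
Variables (Y : set 'rV[R]_m) (Lhat : R).
Hypotheses (Y0 : Y !=set0) (cY : compact Y) (convY : convex_set Y)
  (Lhat0 : 0 < Lhat).
Implicit Types (a b y z w : 'rV[R]_m).

(** Divide by [t] and let it tend to 0. The optimality conditions over convex sets below are read
    off from this along segments. *)
Lemma ge0_first_order (a K : R) :
  (forall t, 0 < t <= 1 -> 0 <= t * a + t ^+ 2 * K) -> 0 <= a.
Proof.
move=> h; rewrite leNgt; apply/negP => a0.
have D0 : 0 < `|K| - a by rewrite subr_gt0 (lt_le_trans a0).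
(* This [t] is small enough that the quadratic term cannot offset half of the negative slope. *)
pose t := - a / (2 * (`|K| - a)).
have D0' : 2 * (`|K| - a) != 0 by rewrite mulf_neq0// gt_eqF.
have tE : t * (2 * (`|K| - a)) = - a by rewrite /t divfK.
have t0 : 0 < t by rewrite /t divr_gt0 ?oppr_gt0 ?mulr_gt0.
have t1 : t <= 1 by rewrite /t ler_pdivrMr ?mulr_gt0// mul1r; have := normr_ge0 K; lra.
have := h t; rewrite t0 t1 => /(_ isT).
rewrite expr2 -mulrA -mulrDr pmulr_rge0// => {}h.
have : t * K <= t * `|K| by rewrite ler_pM2l// ler_norm.
have : t * - a > 0 by rewrite mulr_gt0 ?oppr_gt0.
lra.
Qed.

Let model a y z : R := dotv a (z - y) - Lhat / 2 * enorm (z - y) ^+ 2.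

(** The maximum in [qfun] with the gradient freed into a vector [a]: when [x] varies and [y] is a
    fixed sample, only the gradient moves. *)
Definition proxval a y : R :=
  sup [set dotv a (z - y) - Lhat / 2 * enorm (z - y) ^+ 2 | z in Y].

Lemma continuous_model a y : continuous (model a y).
Proof.
move=> z; apply: (@continuousB _ R^o _ (fun z => dotv a (z - y))
    (fun z => Lhat / 2 * enorm (z - y) ^+ 2)).
  apply: (@continuous_comp _ _ _ (fun z => z - y) (dotv a)).
    by apply: continuousB => //; exact: cst_continuous.
  exact: continuous_dotvr.
apply: (@continuousM _ _ (cst (Lhat / 2)) (fun z => enorm (z - y) ^+ 2)).
  exact: cst_continuous.
exact: continuous_sqr_enorm.
Qed.

Lemma proxval_attained a y : exists2 z, Y z &
  proxval a y = dotv a (z - y) - Lhat / 2 * enorm (z - y) ^+ 2 /\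
  forall w, Y w -> dotv a (w - y) - Lhat / 2 * enorm (w - y) ^+ 2
    <= dotv a (z - y) - Lhat / 2 * enorm (z - y) ^+ 2.
Proof.
have [|z /[!inE] Yz zmax] := @compact_EVT_max _ _ (model a y) _ Y0 cY.
  by apply: continuous_subspaceT => z; exact: continuous_model.
have {}zmax w : Y w -> model a y w <= model a y z by move=> Yw; apply: zmax; rewrite inE.
exists z => //; split => //; apply/eqP; rewrite eq_le; apply/andP; split.
  apply: ge_sup; first by exists (model a y z), z.
  by move=> _ [w Yw <-]; exact: zmax.
apply: ub_le_sup; last by exists z.
by exists (model a y z) => _ [w Yw <-]; exact: zmax.
Qed.

Lemma proxval_ge a y z : Y z ->
  dotv a (z - y) - Lhat / 2 * enorm (z - y) ^+ 2 <= proxval a y.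
Proof. by move=> Yz; have [w _ [-> ]] := proxval_attained a y; apply. Qed.

(** The maximiser for one vector is a competitor for the other, and the quadratic penalties
    cancel. *)
Lemma proxval_lip a b y B : (forall z, Y z -> enorm (z - y) <= B) ->
  `|proxval a y - proxval b y| <= enorm (a - b) * B.
Proof.
move=> hB.
have key c d : proxval c y <= proxval d y + enorm (c - d) * B.
  have [z Yz [-> _]] := proxval_attained c y.
  have := proxval_ge d y Yz; have := dotv_le (c - d) (z - y).
  rewrite dotvBl.
  have := ler_wpM2l (enorm_ge0 (c - d)) (hB _ Yz); lra.
rewrite ler_distl; have := key a b; have := key b a; rewrite (enormB b a) => *.
by apply/andP; split; lra.
Qed.

(** Optimality of [z] along the segment towards [w]: the gradient of the model at [z] is normal to
    [Y]. *)
Lemma prox_variational a y z w : Y z ->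
  (forall w, Y w -> dotv a (w - y) - Lhat / 2 * enorm (w - y) ^+ 2
    <= dotv a (z - y) - Lhat / 2 * enorm (z - y) ^+ 2) ->
  Y w -> dotv (a - Lhat *: (z - y)) (w - z) <= 0.
Proof.
move=> Yz zmax Yw; rewrite -oppr_ge0.
apply: (@ge0_first_order _ (Lhat / 2 * dotv (w - z) (w - z))) => t /andP[t0 t1].
have := zmax _ (convex_set_segment convY Yz Yw (t := t) _); rewrite (ltW t0) t1 => /(_ isT).
rewrite (addrAC z); move: (w - z) (z - y) => d u.
rewrite !sqr_enorm !dotvE (dotvC d u) expr2; lra.
Qed.

End ProxMap.

Section LojasiewiczGrowth.
Context {R : realType} {m : nat}.
Variables (Y : set 'rV[R]_m) (phi : 'rV[R]_m -> R) (g : 'rV[R]_m -> 'rV[R]_m).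
Variables (L Lhat kappa vmax : R).
Hypotheses (cY : compact Y) (convY : convex_set Y).
Hypothesis phic : forall y, Y y -> {for y, continuous phi}.
Hypothesis phi_le : forall y, Y y -> phi y <= vmax.
Hypothesis phi_argmax : exists2 y, Y y & phi y = vmax.
Hypothesis phi_lower : forall y z, Y y -> Y z ->
  phi y + dotv (g y) (z - y) - L / 2 * enorm (z - y) ^+ 2 <= phi z.
Hypothesis phi_upper : forall y z, Y y -> Y z ->
  phi z <= phi y + dotv (g y) (z - y) + L / 2 * enorm (z - y) ^+ 2.
Hypothesis g_lip : forall y z, Y y -> Y z -> enorm (g y - g z) <= L * enorm (y - z).
Hypotheses (L0 : 0 < L) (LLhat : L < Lhat) (kappa0 : 0 < kappa).
Hypothesis PL : forall y xi, Y y -> normal_cone Y y xi ->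
  kappa * (vmax - phi y) <= enorm (- g y + xi) ^+ 2.

Let argmax : set 'rV[R]_m := [set y | Y y /\ phi y = vmax].

Lemma argmax_compact : compact argmax.
Proof.
apply: (subclosed_compact _ cY); last by move=> y [].
move=> p clp.
have Yp : Y p.
  have : closed Y by apply: compact_closed => //; exact: norm_hausdorff.
  by apply; apply: closure_subset clp => y [].
split=> //; apply: contrapT => /eqP pneq.
have [e e0 eE] : exists2 e : R, 0 < e & `|phi p - vmax| = e.
  by exists `|phi p - vmax| => //; rewrite normr_gt0 subr_eq0.
have /cvgrPdist_lt /(_ e e0) /clp [y [[Yy yE] /=]] := phic Yp.
by rewrite yE eE ltxx.
Qed.

(** By concavity the square root lies below its tangent at [s ^+ 2]. This bound replaces
    differentiation of the roots in the next proof. *)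
Lemma sqrt_tangent (a s : R) : 0 <= a -> 0 < s -> Num.sqrt a <= (a + s ^+ 2) / (2 * s).
Proof.
move=> a0 s0; rewrite ler_pdivlMr ?mulr_gt0//.
have := sqr_ge0 (Num.sqrt a - s); rewrite sqrrB sqr_sqrtr//; lra.
Qed.

(* The penalised function sqrt (vmax - phi) + c |. - ybar|, smoothed at ybar, is
   minimised over Y outside the argmax set; its optimality condition exhibits a
   normal vector violating the PL inequality. *)
Lemma sqrt_gap_slope (ybar : 'rV[R]_m) (c D : R) : Y ybar -> 0 < c -> 0 < D ->
  4 * c ^+ 2 < kappa -> (forall u, argmax u -> D <= enorm (u - ybar)) ->
  c * D <= Num.sqrt (vmax - phi ybar).
Proof.
move=> Yb c0 D0 ck hD; rewrite leNgt; apply/negP => sb.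
pose h w := vmax - phi w.
have h0 w : Y w -> 0 <= h w by move=> /phi_le; rewrite subr_ge0.
set sb0 := Num.sqrt _ in sb.
(* With this smoothing width [F ybar] is the midpoint of [sb0] and [c * D], hence below [c * D]. *)
pose e := (D - sb0 / c) / 2.
have ecE : c * e * 2 = c * D - sb0 by rewrite /e; field; rewrite gt_eqF.
have e0 : 0 < e by rewrite /e divr_gt0// subr_gt0 ltr_pdivrMr// mulrC.
pose rho w := Num.sqrt (enorm (w - ybar) ^+ 2 + e ^+ 2).
pose F w := Num.sqrt (h w) + c * rho w.
have Fc : {within Y, continuous F}.
  apply: continuous_in_subspaceT => w /[!inE] Yw.
  apply: (@continuousD _ R^o _ (fun w => Num.sqrt (h w)) (fun w => c * rho w)).
    apply: (@continuous_comp _ _ _ h Num.sqrt); last exact: sqrt_continuous.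
    by apply: (@continuousB _ R^o _ (cst vmax) phi); [exact: cst_continuous|exact: phic].
  apply: (@continuousM _ _ (cst c) rho); first exact: cst_continuous.
  apply: continuous_comp; last exact: sqrt_continuous.
  apply: (@continuousD _ R^o _ (fun w : 'rV[R]_m => enorm (w - ybar) ^+ 2) (cst (e ^+ 2)));
    last exact: cst_continuous.
  exact: continuous_sqr_enorm.
have Yn0 : Y !=set0 by exists ybar.
have [u /[!inE] Yu umin] := compact_EVT_min Yn0 cY Fc.
have {}umin w : Y w -> F u <= F w by move=> Yw; apply: umin; rewrite inE.
have Fb : F ybar = sb0 + c * e.
  by rewrite /F /rho subrr enorm0 expr0n add0r sqrtr_sqr gtr0_norm.
have rge w : enorm (w - ybar) <= rho w.
  rewrite -[leLHS]ger0_norm ?enorm_ge0// -sqrtr_sqr ler_wsqrtr// lerDl.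
  by rewrite sqr_ge0.
(* On the argmax set the penalty alone is at least [c * D], so the minimiser [u] lies outside it,
   and the square root is smooth at [h u]. *)
have hu : 0 < h u.
  rewrite lt_neqAle h0// andbT eq_sym; apply/eqP => hu.
  have /hD Du : argmax u by split => //; move: hu; rewrite /h; lra.
  have := umin _ Yb; rewrite Fb /F hu sqrtr0 add0r.
  have := ler_wpM2l (ltW c0) (le_trans Du (rge u)).
  have : 0 < c * e by rewrite mulr_gt0.
  lra.
have s0 : 0 < Num.sqrt (h u) by rewrite sqrtr_gt0.
have sE : Num.sqrt (h u) ^+ 2 = h u by rewrite sqr_sqrtr ?ltW.
have r0 : 0 < rho u by rewrite sqrtr_gt0 ltr_wpDl ?sqr_ge0// exprn_gt0.
have rE : rho u ^+ 2 = enorm (u - ybar) ^+ 2 + e ^+ 2.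
  by rewrite sqr_sqrtr// addr_ge0 ?sqr_ge0.
set s := Num.sqrt (h u) in s0 sE; set r := rho u in r0 rE.
(* [xi] is [- 2 * s] times the formal gradient of [F] at [u], so minimality makes it a normal
   vector. *)
pose xi := g u - (2 * c * s / r) *: (u - ybar).
have xiN : normal_cone Y u xi.
  move=> w Yw; rewrite /xi dotvBl dotvZl.
  set d := w - u; set ub := u - ybar.
  suff : 0 <= - dotv (g u) d / (2 * s) + c * dotv ub d / r.
    move=> /(mulr_ge0 (ltW s0)) => H.
    suff -> : dotv (g u) d - 2 * c * s / r * dotv ub d =
      - 2 * (s * (- dotv (g u) d / (2 * s) + c * dotv ub d / r)) by lra.
    by field; rewrite !gt_eqF.
  apply: (@ge0_first_order _ _ (L * dotv d d / (4 * s) + c * dotv d d / (2 * r))).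
  move=> t /andP[t0 t1].
  have Yt : Y (u + t *: d) by apply: convex_set_segment => //; rewrite (ltW t0).
  have := umin _ Yt; rewrite /F -/s -/r => Fle.
  have b1 := sqrt_tangent (h0 _ Yt) s0.
  have q0 : 0 <= enorm (u + t *: d - ybar) ^+ 2 + e ^+ 2.
    by rewrite addr_ge0 ?sqr_ge0.
  have b2 := sqrt_tangent q0 r0.
  have hle : h (u + t *: d) <= s ^+ 2 - t * dotv (g u) d + L / 2 * (t ^+ 2 * dotv d d).
    have := phi_lower Yu Yt; rewrite sE /h (addrC u) addrK sqr_enorm !dotvE expr2; lra.
  have qE : enorm (u + t *: d - ybar) ^+ 2 + e ^+ 2 =
            r ^+ 2 + 2 * t * dotv ub d + t ^+ 2 * dotv d d.
    rewrite rE !sqr_enorm (addrAC u) -/ub; clearbody ub d.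
    by rewrite !dotvE (dotvC d ub); ring.
  rewrite qE in b2.
  have b3 : Num.sqrt (h (u + t *: d)) <=
    (s ^+ 2 - t * dotv (g u) d + L / 2 * (t ^+ 2 * dotv d d) + s ^+ 2) / (2 * s).
    by apply: le_trans b1 _; rewrite ler_pM2r ?invr_gt0 ?mulr_gt0// lerD2r.
  have b4 := ler_wpM2l (ltW c0) b2; rewrite -qE -/(rho _) qE in b4.
  have : s + c * r <= (s ^+ 2 - t * dotv (g u) d + L / 2 * (t ^+ 2 * dotv d d) + s ^+ 2) / (2 * s)
     + c * ((r ^+ 2 + 2 * t * dotv ub d + t ^+ 2 * dotv d d + r ^+ 2) / (2 * r)).
    by apply: le_trans Fle _; apply: lerD.
  rewrite -subr_ge0; congr (0 <= _); field; rewrite !gt_eqF//.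
(* Here [- g u + xi] is a multiple of [u - ybar] whose squared norm is at most [4 * c ^+ 2 * h u],
   which is below [kappa * h u]. *)
have := PL Yu xiN; rewrite /xi addKr enormN enormZ -/(h u) -sE exprMn.
rewrite ger0_norm; last by rewrite divr_ge0 ?mulr_ge0 ?ltW.
have E : (2 * c * s / r) ^+ 2 * enorm (u - ybar) ^+ 2 =
  4 * c ^+ 2 * s ^+ 2 * (enorm (u - ybar) / r) ^+ 2.
  by field; rewrite gt_eqF.
have q1 : (enorm (u - ybar) / r) ^+ 2 <= 1.
  rewrite expr_le1// ?divr_ge0 ?enorm_ge0 ?(ltW r0)//.
  by rewrite ler_pdivrMr// mul1r; exact: rge.
rewrite E => H.
have s2 : 0 < s ^+ 2 by rewrite exprn_gt0.
have : 4 * c ^+ 2 * s ^+ 2 * (enorm (u - ybar) / r) ^+ 2 <= 4 * c ^+ 2 * s ^+ 2.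
  by rewrite ler_piMr// mulr_ge0 ?sqr_ge0// mulr_ge0 ?sqr_ge0.
have : 4 * c ^+ 2 * s ^+ 2 < kappa * s ^+ 2 by rewrite ltr_pM2r.
lra.
Qed.

(** The nearest maximiser serves as [ystar]. If the inequality failed, some slope [c] below half the
    root of [kappa] would contradict [sqrt_gap_slope]. *)
Lemma quadratic_growth (y : 'rV[R]_m) : Y y ->
  exists2 ystar, argmax ystar &
    kappa / 4 * enorm (y - ystar) ^+ 2 <= vmax - phi y.
Proof.
move=> Yy.
have A0 : argmax !=set0 by have [z Yz zE] := phi_argmax; exists z.
have [|u /[!inE] Au umin] := @compact_EVT_min _ _ (fun u : 'rV[R]_m => enorm (u - y)) _ A0 argmax_compact.
  by apply: continuous_subspaceT => w; exact: continuous_enormB.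
exists u => //; rewrite enormB leNgt; apply/negP => lt.
have [D0|D0] := eqVneq (enorm (u - y)) 0.
  by move: lt; rewrite D0 expr0n mulr0 subr_lt0 ltNge phi_le.
have {}D0 : 0 < enorm (u - y) by rewrite lt_def D0 enorm_ge0.
set D := enorm _ in lt D0 umin.
have h0 : 0 <= vmax - phi y by rewrite subr_ge0 phi_le.
pose s := Num.sqrt (vmax - phi y).
have s0 : 0 <= s by exact: sqrtr_ge0.
have sE : s ^+ 2 = vmax - phi y by rewrite sqr_sqrtr.
pose k := Num.sqrt kappa.
have k0 : 0 < k by rewrite sqrtr_gt0.
have kE : k ^+ 2 = kappa by rewrite sqr_sqrtr// ltW.
have sD : s < k / 2 * D.
  rewrite -(@ltr_pXn2r _ 2)// ?nnegrE ?mulr_ge0 ?divr_ge0 ?ltW//.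
  by rewrite sE; apply: lt_le_trans lt _; rewrite -kE -/D; nra.
(* The midpoint of [s / D] and [k / 2]: large enough that [c * D] exceeds [s], small enough that
   [4 * c ^+ 2 < kappa]. *)
pose c := (s / D + k / 2) / 2.
have cD : c * D = (s + k / 2 * D) / 2 by rewrite /c; field; rewrite gt_eqF.
have sDk : s / D < k / 2 by rewrite ltr_pdivrMr.
have sD0 : 0 <= s / D by rewrite divr_ge0// ltW.
have c0 : 0 < c by rewrite /c; lra.
have ck : c < k / 2 by rewrite /c; lra.
have := @sqrt_gap_slope y c D Yy c0 D0; rewrite -/s cD => H.
have : (s + k / 2 * D) / 2 <= s.
  apply: H; first by rewrite -kE; nra.
  by move=> w Aw; apply: umin; rewrite inE.
lra.
Qed.

Let q (y : 'rV[R]_m) : R := phi y + proxval Y Lhat (g y) y.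

Let Lhat0 : 0 < Lhat. Proof. exact: lt_trans LLhat. Qed.
Let Y0 : Y !=set0. Proof. by have [y Yy _] := phi_argmax; exists y. Qed.

(** Growth holds at the proximal point [z], and the surplus curvature [Lhat - L] pays for the step
    from [y] to [z]. The modulus results from splitting the distance at [z]. *)
Lemma prox_error_bound (y : 'rV[R]_m) : Y y ->
  exists2 ystar, argmax ystar &
    kappa * (Lhat - L) / (2 * kappa + 8 * (Lhat - L)) * enorm (y - ystar) ^+ 2
      <= vmax - q y.
Proof.
move=> Yy; have [z Yz [zE _]] := proxval_attained Lhat Y0 cY (g y) y.
have [u Au hu] := quadratic_growth Yz; exists u => //.
have LL : 0 < Lhat - L by rewrite subr_gt0.
have low := phi_lower Yy Yz.
have gap : kappa / 4 * enorm (z - u) ^+ 2 + (Lhat - L) / 2 * enorm (z - y) ^+ 2 <= vmax - q y.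
  rewrite /q zE; lra.
apply: le_trans gap.
have tri := enorm_triangle z y u; rewrite (enormB y z) in tri.
have := enorm_ge0 (z - u); have := enorm_ge0 (z - y); have := enorm_ge0 (y - u).
move: tri; set a := enorm (y - u); set b := enorm (z - y); set c := enorm (z - u).
set M := Lhat - L in LL * => tri a0 b0 c0.
have den : 0 < 2 * kappa + 8 * M by rewrite addr_gt0 ?mulr_gt0.
rewrite mulrAC ler_pdivrMr//.
have aa : a ^+ 2 <= (b + c) ^+ 2 by rewrite ler_pXn2r ?nnegrE ?addr_ge0.
have kM : 0 < kappa * M by rewrite mulr_gt0.
have h1 : kappa * M * a ^+ 2 <= kappa * M * (b + c) ^+ 2 by rewrite ler_pM2l.
have h2 : 0 <= (kappa * c - 2 * M * b) ^+ 2 by rewrite sqr_ge0.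
have h4 : 0 <= kappa * M * c ^+ 2 by rewrite mulr_ge0 ?sqr_ge0// ltW.
have h5 : 0 <= M * M * b ^+ 2 by rewrite mulr_ge0 ?sqr_ge0// mulr_ge0 ?ltW.
(* The cross term of the split distance is absorbed into a square; the remaining terms are
   nonnegative. *)
have E : (kappa / 4 * c ^+ 2 + M / 2 * b ^+ 2) * (2 * kappa + 8 * M)
   - kappa * M * (b + c) ^+ 2 = (kappa * c - 2 * M * b) ^+ 2 / 2 + kappa * M * c ^+ 2
    + 2 * (M * M * b ^+ 2).
  by field.
lra.
Qed.

(** [ystar] competes in the proximal problem at [y]; the two quadratic errors, with coefficients
    [L / 2] and [Lhat / 2], add up to at most [Lhat]. *)
Lemma sample_gap (y ystar : 'rV[R]_m) : Y y -> argmax ystar ->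
  vmax - Lhat * enorm (ystar - y) ^+ 2 <= q y.
Proof.
move=> Yy [Ys sE]; rewrite -sE.
have := proxval_ge Lhat Y0 cY (g y) y Ys; have := phi_upper Yy Ys.
have := ler_wpM2r (sqr_ge0 (enorm (ystar - y))) (ltW LLhat).
rewrite /q; lra.
Qed.

Lemma argmax_normal (ystar w : 'rV[R]_m) : argmax ystar -> Y w ->
  dotv (g ystar) (w - ystar) <= 0.
Proof.
move=> [Ys sE] Yw; rewrite -oppr_ge0.
apply: (@ge0_first_order _ _ (L / 2 * enorm (w - ystar) ^+ 2)) => t /andP[t0 t1].
have Yt : Y (ystar + t *: (w - ystar)) by apply: convex_set_segment => //; rewrite (ltW t0).
have := phi_lower Ys Yt; have := phi_le Yt; rewrite sE (addrC ystar) addrK !sqr_enorm !dotvE expr2; lra.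
Qed.

(** Sum of the variational inequalities at [z] and at [ystar], each tested with the other point. The
    vector [a] is free because the gradient will be taken at a displaced [x], at the cost of the
    last term. *)
Lemma prox_argmax_dist (a y ystar z : 'rV[R]_m) : Y y -> argmax ystar -> Y z ->
  (forall w, Y w -> dotv a (w - y) - Lhat / 2 * enorm (w - y) ^+ 2
    <= dotv a (z - y) - Lhat / 2 * enorm (z - y) ^+ 2) ->
  enorm (z - ystar) <= (1 + L / Lhat) * enorm (y - ystar) + enorm (a - g y) / Lhat.
Proof.
move=> Yy As Yz zmax; have Ys := As.1.
have v1 := prox_variational convY Yz zmax Ys.
have v2 := argmax_normal As Yz.
have [z0|z0] := eqVneq (enorm (z - ystar)) 0.
  rewrite z0 addr_ge0 ?divr_ge0 ?mulr_ge0 ?addr_ge0 ?divr_ge0 ?enorm_ge0 ?ltW//.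
have {}z0 : 0 < enorm (z - ystar) by rewrite lt_def z0 enorm_ge0.
rewrite -(ler_pM2r z0) -(ler_pM2l Lhat0).
have E : Lhat * (((1 + L / Lhat) * enorm (y - ystar) + enorm (a - g y) / Lhat) * enorm (z - ystar))
  = Lhat * (enorm (y - ystar) * enorm (z - ystar)) + L * enorm (y - ystar) * enorm (z - ystar)
    + enorm (a - g y) * enorm (z - ystar).
  by field; rewrite gt_eqF.
rewrite E -expr2 sqr_enorm.
have c1 := ler_wpM2l (ltW Lhat0) (dotv_le (y - ystar) (z - ystar)).
have c2 := dotv_le (a - g y) (z - ystar).
have c3 := dotv_le (g y - g ystar) (z - ystar).
have c4 := ler_wpM2r (ltW z0) (g_lip Yy Ys).
have E2 : z - y = (z - ystar) - (y - ystar) by rewrite opprB addrA subrK.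
have E3 : ystar - z = - (z - ystar) by rewrite opprB.
rewrite E2 E3 in v1; move: v1 v2 c1 c2 c3 c4.
move: (z - ystar) (y - ystar) => zs ys.
rewrite !dotvE; lra.
Qed.

End LojasiewiczGrowth.

(** * Clarke subdifferentials and error bounds *)

Lemma near_ltn_forall (T : Type) (F : set_system T) (P : nat -> T -> Prop) (N : nat) :
  Filter F -> (forall j, (j < N)%N -> \forall p \near F, P j p) ->
  \forall p \near F, forall j, (j < N)%N -> P j p.
Proof.
move=> FF; elim: N => [|N IH] h; first by apply: nearW => p j.
have h1 := IH (fun j jN => h j (ltnW jN)); have h2 := h N (leqnn _).
apply: filterS2 h1 h2 => p p1 p2 j.
by rewrite ltnS leq_eqVlt => /orP[/eqP ->//|]; exact: p1.
Qed.

Section FiniteExtrema.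
Context {R : realType}.
Implicit Types (h : nat -> R) (N : nat).

Lemma sup_ltn_attained h N : (0 < N)%N ->
  exists2 j, (j < N)%N & sup [set h i | i in [set i | (i < N)%N]] = h j /\
    forall i, (i < N)%N -> h i <= h j.
Proof.
move=> N0; pose i0 := Ordinal N0.
have [j _ jmax] := @Order.TotalTheory.arg_maxP _ R 'I_N i0 xpredT (fun i => h i) isT.
have {}jmax i : (i < N)%N -> h i <= h j by move=> iN; exact: (jmax (Ordinal iN) isT).
exists j => //; split => //; apply/eqP; rewrite eq_le; apply/andP; split.
  apply: ge_sup; first by exists (h j), j => /=.
  by move=> _ [i iN <-]; exact: jmax.
apply: ub_le_sup; last by exists j => /=.
by exists (h j) => _ [i iN <-]; exact: jmax.
Qed.

Lemma inf_ltn_attained h N : (0 < N)%N ->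
  exists2 j, (j < N)%N & inf [set h i | i in [set i | (i < N)%N]] = h j.
Proof.
move=> N0; have [j jN [_ jmax]] := sup_ltn_attained (fun i => - h i) N0.
exists j => //; apply/eqP; rewrite eq_le; apply/andP; split.
  apply: ge_inf; last by exists j.
  by exists (h j) => _ [i iN <-]; rewrite -lerN2; exact: jmax.
apply: lb_le_inf; first by exists (h j), j.
by move=> _ [i iN <-]; rewrite -lerN2; exact: jmax.
Qed.

End FiniteExtrema.

(** * Covering radius of the samples *)

Section SampleRadius.
Context {R : realType} {m : nat}.
Variables (Y : set 'rV[R]_m) (N : nat) (s : nat -> 'rV[R]_m).
Hypotheses (cY : compact Y) (N0 : (0 < N)%N).

Lemma betaN_cover y : Y y -> exists2 j, (j < N)%N & enorm (y - s j) <= betaN Y N s.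
Proof.
move=> Yy; have [j jN jE] := inf_ltn_attained (fun j => enorm (y - s j)) N0.
exists j => //; rewrite -jE; apply: ub_le_sup; last by exists y.
have [M hM] := enorm_bounded cY.
(* Comparison with the distance to the sample [s 0] bounds the set, so the supremum in [betaN] is a
   genuine one. *)
exists (M + enorm (s 0)) => _ [z Yz <-].
apply: (@le_trans _ _ (enorm (z - s 0))).
  apply: ge_inf; last by exists 0.
  by exists 0 => _ [i _ <-]; exact: enorm_ge0.
by rewrite (le_trans (enormD _ _))// enormN lerD2r hM.
Qed.

Lemma betaN_ge0 : Y !=set0 -> 0 <= betaN Y N s.
Proof. by move=> [y /betaN_cover[j _]]; apply: le_trans; exact: enorm_ge0. Qed.

End SampleRadius.

Section ClarkeSubdifferential.
Context {R : realType} {n : nat}.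
Implicit Types (h : 'rV[R]_n -> R) (x v g : 'rV[R]_n).

(** The upper limit is an infimum of suprema over members of the filter, and the set where the
    quotient is at most [M] is such a member. *)
Lemma clarke_subdiff_le h x v g (M : R) : clarke_subdiff h x g ->
  (\forall p \near filter_prod (nbhs x) (0 : R)^'+,
     (h (p.1 + p.2 *: v) - h p.1) / p.2 <= M) ->
  dotv g v <= M.
Proof.
move=> /(_ v) gle hM; rewrite -lee_fin; apply: le_trans gle _.
apply: ge_ereal_inf; exists (ereal_sup ((fun p : 'rV[R]_n * R =>
  ((h (p.1 + p.2 *: v) - h p.1) / p.2)%:E) @` [set p | (h (p.1 + p.2 *: v) - h p.1) / p.2 <= M])).
  by eexists; [exact: hM|].
by apply: ge_ereal_sup => _ [p pM <-]; rewrite lee_fin.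
Qed.

(** Quotients based at [x] itself suffice, since the base points of the upper limit include [x]. *)
Lemma clarke_subdiff_ge h x g :
  (forall v (e : R), 0 < e -> \forall t \near (0 : R)^'+,
     dotv g v - e <= (h (x + t *: v) - h x) / t) ->
  clarke_subdiff h x g.
Proof.
move=> hg v; apply: le_ereal_inf_tmp => _ [A [[A1 A2] /= [xA1 A2_0] A12] <-].
apply/lee_subgt0Pr => e e0.
have [t [At le]] := filter_ex (filterI A2_0 (hg v e e0)).
apply: le_trans (ereal_sup_ubound _); last first.
  by exists (x, t) => //; apply: A12; split => //=; exact: nbhs_singleton.
by rewrite /= -EFinB lee_fin.
Qed.

Lemma clarke_subdiff_convex h x g g' t : clarke_subdiff h x g ->
  clarke_subdiff h x g' -> 0 <= t <= 1 -> clarke_subdiff h x (g + t *: (g' - g)).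
Proof.
move=> hg hg' /andP[t0 t1] v.
have [le|/ltW le] := leP (dotv g v) (dotv g' v).
  apply: le_trans (hg' v); rewrite lee_fin !dotvE.
  by have := ler_wpM2r (_ : 0 <= dotv g' v - dotv g v) t1; rewrite subr_ge0 => /(_ le); lra.
apply: le_trans (hg v); rewrite lee_fin !dotvE.
by have : 0 <= t * (dotv g v - dotv g' v) by [rewrite mulr_ge0// subr_ge0]; lra.
Qed.

Lemma clarke_subdiff_closed h x : closed (clarke_subdiff h x).
Proof.
rewrite (_ : clarke_subdiff h x = \bigcap_(v in setT)
  [set g | ((dotv g v)%:E <= limf_esup (fun p : 'rV[R]_n * R =>
    ((h (p.1 + p.2 *: v) - h p.1) / p.2)%:E) (filter_prod (nbhs x) (0 : R)^'+))%E]).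
  apply: closed_bigI => v _; move: (limf_esup _ _) => [r| |].
  - apply: (@closed_comp _ _ (fun g => dotv g v) [set a | a <= r]) => [g _|]; last exact: closed_le.
    exact: continuous_dotvl.
  - rewrite (_ : [set _ | _] = setT); first exact: closedT.
    by apply/seteqP; split => // g _ /=; rewrite leey.
  - rewrite (_ : [set _ | _] = set0); first exact: closed0.
    by apply/seteqP; split => // g /=.
by apply/seteqP; split => [g hg v _|g hg v]; [exact: hg|exact: hg].
Qed.

(** Optimality of the nearest point of [K] to [g]. In [residual_le] the vector [g - g'] becomes the
    test direction. *)
Lemma compact_convex_proj (K : set 'rV[R]_n) g : K !=set0 -> compact K ->
  (forall a b t, K a -> K b -> 0 <= t <= 1 -> K (a + t *: (b - a))) ->
  exists2 g', K g' & forall c, K c -> dotv c (g - g') <= dotv g' (g - g').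
Proof.
move=> K0 cK convK.
have [|g' /[!inE] Kg' gmin] := @compact_EVT_min _ _ (fun u : 'rV[R]_n => enorm (u - g)) _ K0 cK.
  by apply: continuous_subspaceT => w; exact: continuous_enormB.
exists g' => // c Kc; rewrite -subr_ge0 -dotvBl.
apply: (@ge0_first_order _ _ (dotv (c - g') (c - g') / 2)) => t /andP[t0 t1].
have Kt : K (g' + t *: (c - g')) by apply: convK => //; rewrite (ltW t0).
have := gmin (g' + t *: (c - g')); rewrite inE => /(_ Kt).
rewrite -(@ler_pXn2r _ 2) ?nnegrE ?enorm_ge0// !sqr_enorm (addrAC g').
have E1 : g' - c = - (c - g') by rewrite opprB.
have E2 : g - g' = - (g' - g) by rewrite opprB.
rewrite E1 E2 {E1 E2}.
move: (c - g') (g' - g) => d u.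
rewrite !dotvE (dotvC u d) expr2; lra.
Qed.

End ClarkeSubdifferential.

(** * Inverse of the error-bound modulus *)

Section ErrorBound.
Context {R : realType} {n : nat}.
Implicit Types (X D : set 'rV[R]_n) (V : 'rV[R]_n -> R) (x : 'rV[R]_n).

Lemma dist_ge0 x D : (0 <= dist x D)%E.
Proof. by apply: le_ereal_inf_tmp => _ [a _ <-]; rewrite lee_fin enorm_ge0. Qed.

(** The witness is [tau = dist x D]: [x] itself belongs to the set over which [eb_modulus] takes its
    infimum. Nonemptiness of [D] makes this distance a real number. *)
Lemma dist_le_eb_modulus_inv X V D x (t : R) : D !=set0 -> X x ->
  (residual X V x <= t%:E)%E -> (dist x D <= eb_modulus_inv X V D t%:E)%E.
Proof.
move=> [a Da] Xx rt; rewrite /eb_modulus_inv /=.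
have dfin : dist x D \is a fin_num.
  rewrite ge0_fin_numE ?dist_ge0//.
  apply: (@le_lt_trans _ _ (enorm (x - a))%:E); last exact: ltry.
  by apply: ereal_inf_lbound; exists a.
rewrite -(fineK dfin); apply: ereal_sup_ubound; exists (fine (dist x D)) => //.
split; first by rewrite fine_ge0 ?dist_ge0.
apply: le_trans rt; apply: ereal_inf_lbound; exists x => //.
by split => //; rewrite fineK.
Qed.

Lemma eb_modulus_inv_le X V D (t t' : \bar R) : (t <= t')%E ->
  (eb_modulus_inv X V D t <= eb_modulus_inv X V D t')%E.
Proof.
move=> tt'; rewrite /eb_modulus_inv.
have [_|t'oo] := eqVneq t' +oo%E; first by rewrite leey.
have [too|_] := eqVneq t +oo%E.
  by move: tt'; rewrite too leye_eq (negbTE t'oo).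
apply: ge_ereal_sup => _ [tau [tau0 le] <-].
by apply: ereal_sup_ubound; exists tau => //; split => //; exact: le_trans le tt'.
Qed.

End ErrorBound.

(** * Stationarity of the sampled problem *)

Section RowMxTopology.
Context {R : realType} {n m : nat}.
Implicit Types (x : 'rV[R]_n) (y : 'rV[R]_m) (A : set 'rV[R]_(n + m)).

Lemma nbhs_row_mx x y A : nbhs (row_mx x y) A ->
  \forall y' \near y & x' \near x, A (row_mx x' y').
Proof.
move=> /nbhs_ballP[e /= e0 eA].
exists (ball y e, ball x e); first by split; exact: nbhsx_ballx.
move=> [y' x'] /= [[_ yy'] [_ xx']]; apply: eA; split=> // i j.
rewrite !mxE; case: (fintype.split j) => k; [exact: xx'|exact: yy'].
Qed.

Lemma nbhs_row_mxl x y A : nbhs (row_mx x y) A -> \forall x' \near x, A (row_mx x' y).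
Proof.
move=> /nbhs_row_mx[[A1 A2] /= [yA1 xA2] A12]; apply: filterS xA2 => x' A2x'.
by apply: (A12 (y, x')); split => //=; exact: nbhs_singleton.
Qed.

Lemma nbhs_row_mxr x y A : nbhs (row_mx x y) A -> \forall y' \near y, A (row_mx x y').
Proof.
move=> /nbhs_row_mx[[A1 A2] /= [yA1 xA2] A12]; apply: filterS yA1 => y' A1y'.
by apply: (A12 (y', x)); split => //=; exact: nbhs_singleton.
Qed.

(** Clarke quotients have a moving base point [p.1], so the mean value theorem needs the whole
    segment starting there to stay in the neighbourhood. *)
Lemma near_segment x v (A : set 'rV[R]_n) : nbhs x A ->
  \forall p \near filter_prod (nbhs x) (0 : R)^'+,
    0 < p.2 /\ forall s, 0 <= s <= 1 -> A (p.1 + s *: (p.2 *: v)).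
Proof.
move=> /nbhs_ballP[e /= e0 eA].
have d0 : 0 < e / 2 / (`|v| + 1) by rewrite !divr_gt0// ltr_wpDl.
exists (ball x (e / 2), [set t | 0 < t < e / 2 / (`|v| + 1)]) => /=.
  split; first by apply: nbhsx_ballx; rewrite divr_gt0.
  have h1 := nbhs_right_gt (0 : R); have h2 := nbhs_right_lt d0.
  by apply: filterS (filterI h1 h2) => t /= [-> ->].
move=> [x' t] /= [xx' /andP[t0 te]]; split=> // s /andP[s0 s1]; apply: eA.
move: xx'; rewrite -!ball_normE/= => xx'.
rewrite opprD addrA (le_lt_trans (ler_normB _ _))// !normrZ (ger0_norm s0) (gtr0_norm t0).
have h1 : s * (t * `|v|) <= t * `|v| by rewrite ler_piMl// mulr_ge0// ltW.
have h2 : t * (`|v| + 1) < e / 2 by rewrite -ltr_pdivlMr// ltr_wpDl.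
lra.
Qed.

End RowMxTopology.

Lemma near_enorm (R : realType) (T : topologicalType) (k : nat)
    (G : T -> 'rV[R]_k) p (e : R) : {for p, continuous G} -> 0 < e ->
  \forall q \near p, enorm (G q - G p) <= e.
Proof.
move=> cG e0.
have := continuous_comp cG (@continuous_enormB _ _ (G p) (G p)).
move=> /cvgrPdist_le /(_ e e0); apply: filterS => q /=.
by rewrite (subrr (G p)) enorm0 sub0r normrN ger0_norm ?enorm_ge0.
Qed.

Section MinimaxStationarity.
Context {R : realType} {n m : nat}.
Variables (X : set 'rV[R]_n) (Y : set 'rV[R]_m) (f : 'rV[R]_(n + m) -> R).
Variables (L Lhat : R) (U : set 'rV[R]_(n + m)).
Hypotheses (Y0 : Y !=set0) (cY : compact Y) (convY : convex_set Y).
Hypotheses (L0 : 0 < L) (LLhat : L < Lhat).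
Hypotheses (oU : open U) (XYU : prodset X Y `<=` U) (f2 : C2_on U f).
Hypothesis grad_lip : forall p p', prodset X Y p -> prodset X Y p' ->
  enorm (grad f p - grad f p') <= L * enorm (p - p').
Hypothesis grad_bound : forall p, prodset X Y p -> enorm (grad f p) <= L.
Implicit Types (x v : 'rV[R]_n) (y z w : 'rV[R]_m).

Let Lhat0 : 0 < Lhat. Proof. exact: lt_trans LLhat. Qed.

Lemma prodset_row_mx x y : X x -> Y y -> prodset X Y (row_mx x y).
Proof. by move=> Xx Yy; exists x => //; exists y. Qed.

Let inU x y : X x -> Y y -> U (row_mx x y).
Proof. by move=> Xx Yy; apply: XYU; exact: prodset_row_mx. Qed.

Let row_mxBr x y z : row_mx x z - row_mx x y = row_mx 0 (z - y).
Proof. by rewrite opp_row_mx add_row_mx subrr. Qed.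

Let row_mx_line x y w (s : R) : row_mx x y + s *: row_mx 0 w = row_mx x (y + s *: w).
Proof. by rewrite scale_row_mx scaler0 add_row_mx addr0. Qed.

Let row_mx_linel x y v (s : R) : row_mx x y + s *: row_mx v 0 = row_mx (x + s *: v) y.
Proof. by rewrite scale_row_mx scaler0 add_row_mx addr0. Qed.

Lemma fibre_continuous x y : U (row_mx x y) ->
  {for y, continuous (fun y => f (row_mx x y))}.
Proof.
move=> Uxy; have [/differentiable_continuous fc _ _] := f2 Uxy.
by move=> A /fc; exact: nbhs_row_mxr.
Qed.

(** The hypothesis concerns the fibre and not membership of [x] in [X], because difference quotients
    may evaluate [Vmax] outside [X]. *)
Lemma Vmax_attained x : (forall y, Y y -> U (row_mx x y)) ->
  exists2 y, Y y & Vmax Y f x = f (row_mx x y) /\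
    forall z, Y z -> f (row_mx x z) <= f (row_mx x y).
Proof.
move=> xU; have [|y /[!inE] Yy ymax] := @compact_EVT_max _ _ (fun y => f (row_mx x y)) _ Y0 cY.
  by apply: continuous_in_subspaceT => y /[!inE] /xU; exact: fibre_continuous.
have {}ymax z : Y z -> f (row_mx x z) <= f (row_mx x y) by move=> Yz; apply: ymax; rewrite inE.
exists y => //; split => //; apply/eqP; rewrite eq_le; apply/andP; split.
  apply: ge_sup; first by exists (f (row_mx x y)), y.
  by move=> _ [w Yw <-]; exact: ymax.
apply: ub_le_sup; last by exists y.
by exists (f (row_mx x y)) => _ [w Yw <-]; exact: ymax.
Qed.

(** Tube lemma, from compactness of [Y]. *)
Lemma fibre_near x : X x -> \forall x' \near x, forall y, Y y -> U (row_mx x' y).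
Proof.
move=> Xx; have /compact_near_coveringP := cY.
move=> /(_ _ (nbhs x) (fun x' y => U (row_mx x' y)) _); apply => y Yy.
apply: nbhs_row_mx; apply: open_nbhs_nbhs; split => //; exact: inU.
Qed.

(** * First- and second-order estimates on the fibre over a point of X *)

Section Fibre.
Variable x : 'rV[R]_n.
Hypothesis Xx : X x.

Let vmax_le y : Y y -> f (row_mx x y) <= Vmax Y f x.
Proof.
by move=> Yy; have [|z _ [-> ]] := @Vmax_attained x; [move=> *; exact: inU|exact].
Qed.

Let vmax_ex : exists2 y, Y y & f (row_mx x y) = Vmax Y f x.
Proof. by have [|z Yz [-> _]] := @Vmax_attained x; [move=> *; exact: inU|exists z]. Qed.

Lemma fibre_segment y z (s : R) : Y y -> Y z -> 0 <= s <= 1 ->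
  prodset X Y (row_mx x y + s *: row_mx 0 (z - y)).
Proof.
by move=> Yy Yz s01; rewrite row_mx_line; apply: prodset_row_mx => //; exact: convex_set_segment.
Qed.

(** [descent01] on the segment from [y] to [z], which convexity keeps in the product set; the two
    signs give the two-sided bound. *)
Lemma fibre_descent y z : Y y -> Y z ->
  `|f (row_mx x z) - f (row_mx x y) - dotv (grad_y f x y) (z - y)|
    <= L / 2 * enorm (z - y) ^+ 2.
Proof.
move=> Yy Yz; pose w : 'rV[R]_(n + m) := row_mx 0 (z - y).
pose phi (s : R) := f (row_mx x y + s *: w).
pose dphi (s : R) := dotv (grad f (row_mx x y + s *: w)) w.
have dphiE (s : R) : 0 <= s <= 1 -> is_derive s 1 phi (dphi s).
  move=> s01; have [df _ _] := f2 (XYU (fibre_segment Yy Yz s01)).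
  by rewrite /dphi -diff_dotv_grad//; exact: is_derive_line.
have w2 : enorm w = enorm (z - y) by rewrite enorm_row_0mx.
have bound (s : R) : 0 <= s <= 1 -> `|dphi s - dphi 0| <= L * enorm w ^+ 2 * s.
  move=> s01; have s0 : 0 <= s by case/andP: s01.
  rewrite /dphi -dotvBl; apply: le_trans (normr_dotv_le _ _) _.
  have := grad_lip (fibre_segment Yy Yz s01) (fibre_segment (s := 0) Yy Yz _).
  rewrite lexx ler01 => /(_ isT); rewrite scale0r addr0 [_ + _ - row_mx x y]addrC addKr.
  rewrite enormZ ger0_norm// => /(ler_wpM2r (enorm_ge0 w)) /le_trans; apply.
  by rewrite le_eqVlt; apply/orP; left; apply/eqP; rewrite -/w; ring.
have phi1 : phi 1 = f (row_mx x z).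
  by rewrite /phi scale1r -[w]scale1r row_mx_line scale1r addrC subrK.
have phi0 : phi 0 = f (row_mx x y) by rewrite /phi scale0r addr0.
have dphi0 : dphi 0 = dotv (grad_y f x y) (z - y).
  by rewrite /dphi scale0r addr0 dotv_row_0mx.
rewrite -phi1 -phi0 -dphi0 -w2 ler_norml; apply/andP; split; last first.
  have := descent01 dphiE (K := L * enorm w ^+ 2) _; rewrite mulrAC; apply.
  by move=> s /bound; rewrite ler_norml => /andP[].
have dphiN (s : R) : 0 <= s <= 1 -> is_derive s 1 (- phi) (- dphi s).
  by move=> /dphiE ds; exact: is_deriveN.
have := descent01 dphiN (K := L * enorm w ^+ 2) _.
have bN : forall s : R, 0 <= s <= 1 -> - dphi s - - dphi 0 <= L * enorm w ^+ 2 * s.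
  by move=> s /bound; rewrite ler_norml => /andP[]; lra.
move=> /(_ bN); rewrite /= !fctE; lra.
Qed.

Lemma fibre_grad_lip y z : Y y -> Y z ->
  enorm (grad f (row_mx x y) - grad f (row_mx x z)) <= L * enorm (y - z).
Proof.
move=> Yy Yz; rewrite -(enorm_row_0mx n (y - z)) -(row_mxBr x).
by apply: grad_lip; exact: prodset_row_mx.
Qed.

Lemma fibre_grad_y_lip y z : Y y -> Y z ->
  enorm (grad_y f x y - grad_y f x z) <= L * enorm (y - z).
Proof.
move=> Yy Yz; apply: le_trans (fibre_grad_lip Yy Yz).
by rewrite /grad_y -linearB; exact: enorm_rsubmx.
Qed.

(* X x Y may have empty interior, so only the directions tangent to it are
   controlled by the Lipschitz constant of the gradient. *)
Lemma hess_fibre_bound y z (c : 'rV[R]_(n + m)) : Y y -> Y z ->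
  dotv (row_mx 0 (z - y) *m hess f (row_mx x y)) c <= L * enorm (z - y) * enorm c.
Proof.
move=> Yy Yz; set w := row_mx 0 (z - y); set p := row_mx x y.
apply/ler_addgt0Pr => e e0.
have d0 : 0 < e / (enorm c + 1) by rewrite divr_gt0// ltr_wpDl ?enorm_ge0.
have Up : U p by exact: inU.
have [t0 t00 ht0] := nbhs_parallelogram w 0 (hess_near w oU f2 Up d0).
(* [t0] keeps the Hessian close to its value at [p]; the cap 1 keeps the endpoint in the product
   set, where the gradient is Lipschitz. *)
pose t := Num.min t0 1.
have t0' : 0 < t by rewrite lt_min t00 ltr01.
have tt0 : t <= t0 by rewrite ge_min lexx.
have t1 : t <= 1 by rewrite ge_min lexx orbT.
have st (s : R) : 0 <= s <= 1 -> 0 <= s * t <= t.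
  by move=> /andP[s0 s1]; rewrite mulr_ge0 ?(ltW t0')//= ler_piMl// ltW.
have A (s : R) : 0 <= s <= t -> U (p + s *: w) /\
    enorm (w *m hess f (p + s *: w) - w *m hess f p) <= e / (enorm c + 1).
  move=> /andP[s0 s1]; have := ht0 s 0; rewrite scaler0 addr0; apply.
    by rewrite s0 (le_trans s1).
  by rewrite lexx ltW.
have [s01 /st s01' |s /st s01] := @mvt01 R
  (fun s => dotv (grad f (p + s *: (t *: w))) c)
  (fun s => dotv ((t *: w) *m jacobian (grad f) (p + s *: (t *: w))) c).
  apply: is_derive_dotv_line; rewrite scalerA.
  by have [/f2[]] := A _ s01'.
rewrite scale1r scale0r addr0 -dotvBl scalerA -/(hess f _).
have [_ hs] := A _ s01.
have := fibre_segment (s := t) Yy Yz _; rewrite t1 (ltW t0') -/w -/p => /(_ isT) pt.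
have := grad_lip pt (prodset_row_mx Xx Yy).
rewrite -/p [p + _ - p]addrC addKr enormZ gtr0_norm//.
move: hs; move: (hess f (p + _)) (hess f p) (grad f (p + _)) (grad f p).
have -> : enorm (z - y) = enorm w by rewrite enorm_row_0mx.
clearbody w; move=> H1 H0 G1 G0 hs hG.
rewrite -scalemxAl dotvZl => E.
have b1 := dotv_le (G1 - G0) c.
have b2 := ler_wpM2r (enorm_ge0 c) hG.
have b3 : dotv (w *m H1) c <= L * enorm w * enorm c.
  by rewrite -(ler_pM2l t0') -E; lra.
have := dotv_le (w *m H0 - w *m H1) c; rewrite dotvBl enormB.
have := ler_wpM2r (enorm_ge0 c) hs.
have : e / (enorm c + 1) * enorm c <= e.
  by rewrite mulrAC ler_pdivrMr ?ltr_wpDl ?enorm_ge0// ler_pM2l// lerDl.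
lra.
Qed.

Lemma qfunE x' y : qfun Y f Lhat x' y = f (row_mx x' y) + proxval Y Lhat (grad_y f x' y) y.
Proof. by []. Qed.

Lemma fibre_error_bound (kappa : R) y : 0 < kappa ->
  (forall y xi, Y y -> normal_cone Y y xi ->
     kappa * (Vmax Y f x - f (row_mx x y)) <= enorm (- grad_y f x y + xi) ^+ 2) ->
  Y y -> exists2 ys, Y ys /\ f (row_mx x ys) = Vmax Y f x &
    kappa * (Lhat - L) / (2 * kappa + 8 * (Lhat - L)) * enorm (y - ys) ^+ 2
      <= Vmax Y f x - qfun Y f Lhat x y.
Proof.
move=> kappa0 PL Yy.
apply: (@prox_error_bound _ _ Y (fun y => f (row_mx x y)) (grad_y f x) L Lhat kappa) => //.
- by move=> z Yz; apply: fibre_continuous; exact: inU.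
- by move=> z w Yz Yw; have := fibre_descent Yz Yw; rewrite ler_norml => /andP[]; lra.
Qed.

Lemma fibre_sample_gap y ys : Y y -> Y ys -> f (row_mx x ys) = Vmax Y f x ->
  Vmax Y f x - Lhat * enorm (ys - y) ^+ 2 <= qfun Y f Lhat x y.
Proof.
move=> Yy Yys ysE.
apply: (@sample_gap _ _ Y (fun y => f (row_mx x y)) (grad_y f x) L Lhat) => //.
by move=> z w Yz Yw; have := fibre_descent Yz Yw; rewrite ler_norml => /andP[]; lra.
Qed.

Lemma fibre_prox_argmax_dist (a : 'rV[R]_m) y ys z : Y y -> Y z ->
  Y ys -> f (row_mx x ys) = Vmax Y f x ->
  (forall w, Y w -> dotv a (w - y) - Lhat / 2 * enorm (w - y) ^+ 2
    <= dotv a (z - y) - Lhat / 2 * enorm (z - y) ^+ 2) ->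
  enorm (z - ys) <= (1 + L / Lhat) * enorm (y - ys) + enorm (a - grad_y f x y) / Lhat.
Proof.
move=> Yy Yz Yys ysE.
apply: (@prox_argmax_dist _ _ Y (fun y => f (row_mx x y)) (grad_y f x) L Lhat (Vmax Y f x)) => //.
- by move=> ? ? Yz1 Yw1; have := fibre_descent Yz1 Yw1; rewrite ler_norml => /andP[]; lra.
- exact: fibre_grad_y_lip.
Qed.

Lemma near_first_order y (e : R) : Y y -> 0 < e ->
  \forall x' \near x, [/\ U (row_mx x' y),
    `|f (row_mx x' y) - f (row_mx x y)| <= e &
    enorm (grad f (row_mx x' y) - grad f (row_mx x y)) <= e].
Proof.
move=> Yy e0; have Up := inU Xx Yy.
have [/differentiable_continuous fc /differentiable_continuous gc _] := f2 Up.
apply: (@nbhs_row_mxl _ _ _ _ _ [set q | [/\ U q, `|f q - f (row_mx x y)| <= e &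
   enorm (grad f q - grad f (row_mx x y)) <= e]]).
have h1 : nbhs (row_mx x y) U by apply: open_nbhs_nbhs.
have /cvgrPdist_le /(_ e e0) h2 := fc.
have h3 := near_enorm gc e0.
by apply: filterS3 h1 h2 h3 => q q1; rewrite distrC => q2 q3; split.
Qed.

Lemma qfun_near y (e : R) : Y y -> 0 < e ->
  \forall x' \near x, `|qfun Y f Lhat x' y - qfun Y f Lhat x y| <= e.
Proof.
move=> Yy e0; have B0 := diameter_ge0 cY Y0.
have hB y1 y2 : Y y1 -> Y y2 -> enorm (y2 - y1) <= diameter Y by move=> *; exact: le_diameter.
move: (diameter Y) B0 hB => B B0 hB.
have D0 : 0 < 1 + B by rewrite ltr_wpDr.
have d0 : 0 < e / (1 + B) by rewrite divr_gt0.
apply: filterS (near_first_order Yy d0) => x' [_ df dg].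
rewrite !qfunE opprD addrACA (le_trans (ler_normD _ _))//.
have := proxval_lip Lhat Y0 cY (grad_y f x' y) (grad_y f x y) (fun z => hB y z Yy).
have : enorm (grad_y f x' y - grad_y f x y) <= e / (1 + B).
  by apply: le_trans dg; rewrite /grad_y -linearB; exact: enorm_rsubmx.
move=> /(ler_wpM2r B0).
have : e / (1 + B) * (1 + B) = e by rewrite divfK// gt_eqF.
lra.
Qed.

(** The proximal point at the moved end of the segment is a competitor at its base, so the increment
    of [qfun] is at most that of a smooth function. Replacing [y] by [ys] in the gradient costs one
    multiple of [L * enorm (y - ys)], and the mixed second-order term costs the other
    [2 + L / Lhat]. *)
Lemma qfun_quotient y ys v (e : R) : Y y -> Y ys -> f (row_mx x ys) = Vmax Y f x ->
  0 < e -> \forall p \near filter_prod (nbhs x) (0 : R)^'+,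
  (qfun Y f Lhat (p.1 + p.2 *: v) y - qfun Y f Lhat p.1 y) / p.2 <=
    dotv (lsubmx (grad f (row_mx x ys))) v
      + (3 + L / Lhat) * L * enorm (y - ys) * enorm v + e.
Proof.
move=> Yy Yys ysE e0; have B0 := diameter_ge0 cY Y0.
have hB y1 y2 : Y y1 -> Y y2 -> enorm (y2 - y1) <= diameter Y by move=> *; exact: le_diameter.
move: (diameter Y) B0 hB => B B0 hB.
(* [C] counts the errors of size [d]: in the gradient, in the proximal point, in the Hessian, and
   one to spare. *)
pose C := enorm v + L * enorm v / Lhat + B + 1.
have C0 : 0 < C.
  by rewrite ltr_wpDl// !addr_ge0 ?divr_ge0 ?mulr_ge0 ?enorm_ge0 ?(ltW L0) ?(ltW Lhat0).
have d0 : 0 < e / C by rewrite divr_gt0.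
pose d := e / C; have dE : d * C = e by rewrite /d divfK// gt_eqF.
pose vv : 'rV[R]_(n + m) := row_mx v 0.
have vvE : enorm vv = enorm v by rewrite enorm_row_mx0.
have nb := near_segment v (@filterI _ _ (nbhs_filter x) _ _ (near_first_order Yy d0)
  (nbhs_row_mxl (hess_near vv oU f2 (inU Xx Yy) d0))).
apply: filterS nb => -[x' t] /= [t0 seg]; rewrite ler_pdivrMr//.
have seg1 := seg 1; rewrite ler01 lexx scale1r in seg1.
have [[_ _ g1] _] := seg1 isT; clear seg1.
have [z Yz [zE zmax]] := proxval_attained Lhat Y0 cY (grad_y f (x' + t *: v) y) y.
pose W : 'rV[R]_(n + m) := row_mx 0 (z - y).
pose p' : 'rV[R]_(n + m) := row_mx x' y.
(* With [z] frozen and the quadratic penalty left out, [psi] equals [qfun] at the moved end and is a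
   lower bound for it at the base. *)
pose psi (s : R) := f (p' + s *: (t *: vv)) + dotv (grad f (p' + s *: (t *: vv))) W.
pose dpsi (s : R) := dotv (grad f (p' + s *: (t *: vv))) (t *: vv)
  + dotv ((t *: vv) *m jacobian (grad f) (p' + s *: (t *: vv))) W.
have p'E (s : R) : p' + s *: (t *: vv) = row_mx (x' + s *: (t *: v)) y.
  by rewrite -row_mx_linel scale_row_mx scaler0.
have [s s01|s s01 sE] := @mvt01 R psi dpsi.
  have [[Us _ _] _] := seg s s01; rewrite -p'E in Us.
  have [df dg _] := f2 Us.
  rewrite /dpsi -diff_dotv_grad//.
  by apply: is_deriveD; [exact: is_derive_line|exact: is_derive_dotv_line].
have key : qfun Y f Lhat (x' + t *: v) y - qfun Y f Lhat x' y <= dpsi s.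
  rewrite -sE /psi !p'E !scale1r !scale0r !addr0 !qfunE zE !dotv_row_0mx.
  have := proxval_ge Lhat Y0 cY (grad_y f x' y) y Yz; rewrite /grad_y.
  move: (proxval _ _ _ _) (enorm _) (f _) (f _) (dotv _ _) (dotv _ _).
  move=> a1 a2 a3 a4 a5 a6; lra.
apply: le_trans key _; rewrite /dpsi.
have [[_ _ gs] [_ hs]] := seg s s01; rewrite p'E -/(hess f _).
(* The derivative of [psi] applies the Hessian to [vv], whereas [hess_fibre_bound] controls it on
   the fibre direction [W]. *)
have hsym := schwarz_symmetry vv W oU f2 (inU Xx Yy).
have hbd := hess_fibre_bound vv Yy Yz; rewrite -/W in hbd.
have ydist : enorm (grad f (row_mx x y) - grad f (row_mx x ys)) <= L * enorm (y - ys).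
  exact: fibre_grad_lip.
have zdist := fibre_prox_argmax_dist Yy Yz Yys ysE zmax.
have gy : enorm (grad_y f (x' + t *: v) y - grad_y f x y) <= d.
  by apply: le_trans g1; rewrite /grad_y -linearB; exact: enorm_rsubmx.
have WB : enorm W <= B by rewrite /W enorm_row_0mx; exact: hB.
have tri := enorm_triangle ys z y; rewrite (enormB ys y) in tri.
(* Splitting at [ys]: [1 + L / Lhat] comes from the proximal estimate, and 1 from [enorm (y - ys)]
   itself. *)
have zy : enorm (z - y) <= (2 + L / Lhat) * enorm (y - ys) + d / Lhat.
  apply: le_trans tri _; rewrite -lerBrDr; apply: le_trans zdist _.
  rewrite -lerBrDl (_ : (_ - _ : R) = d / Lhat); first by rewrite ler_pM2r ?invr_gt0.
  by move: (enorm _) => rho; ring.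
rewrite -dotv_row_mx0 -/vv.
move: hs hsym hbd ydist gs.
move: (hess f (row_mx (x' + _) y)) (hess f (row_mx x y)) => H1 H0.
move: (grad f (row_mx (x' + _) y)) (grad f (row_mx x y)) (grad f (row_mx x ys)).
move=> G1 G0 Gs hs hsym hbd ydist gs.
rewrite -scalemxAl dotvZl dotvZr -mulrDr mulrC ler_pM2r//.
have b1 := dotv_le (G1 - G0) vv; have b2 := dotv_le (G0 - Gs) vv.
have b3 := dotv_le (vv *m H1 - vv *m H0) W.
rewrite !dotvBl vvE in b1 b2 b3; rewrite vvE in hbd.
have v0 := enorm_ge0 v.
have c1 := ler_wpM2r v0 gs; have c2 := ler_wpM2r v0 ydist.
have c3 := ler_wpM2r (enorm_ge0 W) hs; have c4 := ler_wpM2l (ltW d0) WB.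
have c5 := ler_wpM2r v0 (ler_wpM2l (ltW L0) zy).
have eE : e = d * enorm v + L * (d / Lhat) * enorm v + d * B + d.
  by rewrite -dE /C; field; rewrite gt_eqF.
have d0' := d0; rewrite -/d in c1 c3 c4 d0'.
lra.
Qed.

(** [Vmax] dominates [f] at the fixed [ys], with equality at [x], so its quotients based at [x]
    dominate those of [f], which converge to the directional derivative. *)
Lemma grad_in_clarke_subdiff ys : Y ys -> f (row_mx x ys) = Vmax Y f x ->
  clarke_subdiff (Vmax Y f) x (lsubmx (grad f (row_mx x ys))).
Proof.
move=> Yys ysE; apply: clarke_subdiff_ge => v e e0.
pose vv : 'rV[R]_(n + m) := row_mx v 0.
have [df _ _] := f2 (inU Xx Yys).
have fd : \forall t \near (0 : R)^'+,
    `|dotv (lsubmx (grad f (row_mx x ys))) v -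
      t^-1 * (f (row_mx (x + t *: v) ys) - f (row_mx x ys))| <= e.
  have /cvgrPdist_le /(_ e e0) := @diff_derivable _ _ _ f (row_mx x ys) vv df.
  rewrite -/(derive _ _ _) deriveE// diff_dotv_grad// dotv_row_mx0.
  rewrite /dnbhs /at_right !near_withinE; apply: filterS => t h t0.
  by move: (h (lt0r_neq0 t0)); rewrite /= (addrC (t *: vv)) row_mx_linel.
(* Nearby fibres stay in [U], so [Vmax] at [x + t *: v] is an attained maximum. *)
have [t0 t00 ht0] := nbhs_parallelogram v 0 (fibre_near Xx).
apply: filterS3 fd (nbhs_right_gt 0) (nbhs_right_lt t00) => t fdt t_gt0 tlt.
have [|z _ [Vz zmax]] := @Vmax_attained (x + t *: v).
  have := ht0 t 0; rewrite scaler0 addr0; apply; first by rewrite !ltW.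
  by rewrite lexx ltW.
have : t^-1 * (f (row_mx (x + t *: v) ys) - f (row_mx x ys)) <=
       (Vmax Y f (x + t *: v) - Vmax Y f x) / t.
  by rewrite mulrC ler_pM2r ?invr_gt0// ysE lerD2r Vz; exact: zmax.
move: fdt; rewrite ler_distl => /andP[_]; lra.
Qed.

End Fibre.

Variables (N : nat) (s : nat -> 'rV[R]_m).
Hypotheses (N0 : (0 < N)%N) (sY : forall j, (j < N)%N -> Y (s j)).

Let beta : R := betaN Y N s.

Let beta0 : 0 <= beta. Proof. exact: betaN_ge0. Qed.

(** * Residual of V at a stationary point of V_N *)

Section Residual.
Variables (x : 'rV[R]_n) (kappa : R).
Hypotheses (Xx : X x) (kappa0 : 0 < kappa).
Hypothesis PL : forall y xi, Y y -> normal_cone Y y xi ->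
  kappa * (Vmax Y f x - f (row_mx x y)) <= enorm (- grad_y f x y + xi) ^+ 2.

Let kq : R := kappa * (Lhat - L) / (2 * kappa + 8 * (Lhat - L)).

Let kq0 : 0 < kq.
Proof.
have LL : 0 < Lhat - L by rewrite subr_gt0.
by rewrite divr_gt0 ?mulr_gt0// addr_gt0// mulr_gt0.
Qed.

(** Activity allows a deficit of [Lhat * beta ^+ 2] below [Vmax]; by [some_sample_active], every
    sample attaining [VNmax] at [x] is active. The error bound turns the deficit into a distance. *)
Lemma active_sample_near_argmax j : (j < N)%N ->
  Vmax Y f x - Lhat * beta ^+ 2 <= qfun Y f Lhat x (s j) ->
  exists2 ys, Y ys /\ f (row_mx x ys) = Vmax Y f x &
    enorm (s j - ys) <= Num.sqrt (Lhat / kq) * beta.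
Proof.
move=> jN qj; have [ys hys le] := fibre_error_bound Xx kappa0 PL (sY jN).
exists ys => //.
rewrite -(@ler_pXn2r _ 2) ?nnegrE ?mulr_ge0 ?sqrtr_ge0 ?enorm_ge0//.
rewrite exprMn (@sqr_sqrtr _ (Lhat / kq)); last exact: divr_ge0 (ltW Lhat0) (ltW kq0).
have E : kq * (Lhat / kq * beta ^+ 2) = Lhat * beta ^+ 2.
  by rewrite [LHS]mulrA (mulrC kq) divfK ?gt_eqF.
rewrite -(ler_pM2l kq0) E; apply: le_trans le _; lra.
Qed.

(** Any sample within [beta] of a maximiser [ys] will do. *)
Lemma some_sample_active : exists2 j, (j < N)%N &
  Vmax Y f x - Lhat * beta ^+ 2 <= qfun Y f Lhat x (s j).
Proof.
have [|ys Yys [ysE _]] := @Vmax_attained x; first by move=> *; exact: inU.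
have [j jN hj] := betaN_cover s cY N0 Yys; exists j => //.
have le := fibre_sample_gap Xx (sY jN) Yys (esym ysE); apply: le_trans le.
rewrite lerD2l lerN2 ler_pM2l// ler_pXn2r// nnegrE ?enorm_ge0//.
Qed.

(** The ball makes the set compact, as the projection requires, and [grad_bound] keeps the partial
    gradients at all maximisers inside. *)
Let K : set 'rV[R]_n := [set g | clarke_subdiff (Vmax Y f) x g /\ enorm g <= L].

(** The quotient of a maximum is at most that of the sample attaining it at the moved end. Near [x]
    this sample is active, since the inactive ones stay below the active sample [j0]. *)
Lemma VNmax_quotient g v (e : R) : 0 < e ->
  (forall c, K c -> dotv c v <= dotv g v) ->
  \forall p \near filter_prod (nbhs x) (0 : R)^'+,
  (VNmax Y f Lhat N s (p.1 + p.2 *: v) - VNmax Y f Lhat N s p.1) / p.2 <=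
    dotv g v + (3 + L / Lhat) * L * (Num.sqrt (Lhat / kq) * beta) * enorm v + e.
Proof.
move=> e0 hg; set M := _ + e.
pose q x' j := qfun Y f Lhat x' (s j).
have [j0 j0N hj0] := some_sample_active.
have near_j j : (j < N)%N -> \forall p \near filter_prod (nbhs x) (0 : R)^'+,
    0 < p.2 /\ (q (p.1 + p.2 *: v) j0 <= q (p.1 + p.2 *: v) j ->
    (q (p.1 + p.2 *: v) j - q p.1 j) / p.2 <= M).
  move=> jN; have [act|inact] := leP (Vmax Y f x - Lhat * beta ^+ 2) (q x j).
    have [ys [Yys ysE] dys] := active_sample_near_argmax jN act.
    have h1 := near_segment v (@filterT _ _ (nbhs_filter x)).
    have h2 := qfun_quotient Xx v (sY jN) Yys ysE e0.
    apply: filterS2 h1 h2 => p [p0 _] pM; split=> // _; apply: le_trans pM _.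
    (* [hg] replaces the gradient at [ys], which depends on [j], by the common vector [g]. *)
    rewrite /M lerD2r; apply: lerD.
      apply: hg; split; first exact: grad_in_clarke_subdiff.
      apply: le_trans (grad_bound (prodset_row_mx Xx Yys)); exact: enorm_lsubmx.
    rewrite ler_wpM2r ?enorm_ge0// ler_wpM2l//.
    by rewrite mulr_ge0 ?addr_ge0 ?divr_ge0 ?(ltW L0) ?(ltW Lhat0).
  (* A third of the gap at [x]: if both values move by at most that much, their strict order
     persists. *)
  have gap : 0 < (q x j0 - q x j) / 3.
    by rewrite divr_gt0// subr_gt0; exact: lt_le_trans inact hj0.
  have h := near_segment v (@filterI _ _ (nbhs_filter x) _ _
    (qfun_near Xx (sY jN) gap) (qfun_near Xx (sY j0N) gap)).
  apply: filterS h => p [p0 seg]; split=> // le; exfalso.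
  have := seg 1; rewrite ler01 lexx scale1r => /(_ isT) [].
  rewrite -/(q _ _) !ler_distl -!/(q _ _) => /andP[_ a1] /andP[a2 _].
  move: (q _ j0) (q _ j) (q x j0) (q x j) le gap a1 a2 => A B C D; lra.
apply: filterS (near_ltn_forall _ near_j) => p hp.
have [j jN [VE jmax]] := sup_ltn_attained (q (p.1 + p.2 *: v)) N0.
have [i iN [VE' imax]] := sup_ltn_attained (q p.1) N0.
have [p0 /(_ (jmax _ j0N)) hj] := hp j jN.
have E : VNmax Y f Lhat N s (p.1 + p.2 *: v) = q (p.1 + p.2 *: v) j by exact: VE.
have E' : VNmax Y f Lhat N s p.1 = q p.1 i by exact: VE'.
(* [q p.1 i] is the maximum at the base, so exchanging it for [q p.1 j] can only raise the
   quotient. *)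
rewrite E E'; apply: le_trans hj.
rewrite ler_pM2r ?invr_gt0// lerD2l lerN2; exact: imax.
Qed.

Lemma residual_le : stationary X (VNmax Y f Lhat N s) x ->
  (residual X (Vmax Y f) x <=
   ((3 + L / Lhat) * L * (Num.sqrt (Lhat / kq) * beta))%:E)%E.
Proof.
move=> [_ [g dg [xi nxi gxi]]]; set eps := (3 + _) * _ * _.
have K0 : K !=set0.
  have [|ys Yys [ysE _]] := @Vmax_attained x; first by move=> *; exact: inU.
  exists (lsubmx (grad f (row_mx x ys))); split; first exact: grad_in_clarke_subdiff.
  apply: le_trans (grad_bound (prodset_row_mx Xx Yys)); exact: enorm_lsubmx.
have cK : compact K.
  apply: bounded_closed_compact.
    exists L; split; first exact: num_real.
    move=> r Lr c [_ cL]; apply: le_trans (mx_norm_le_enorm c) _.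
    by apply: le_trans cL _; exact: ltW.
  apply: closedI; first exact: clarke_subdiff_closed.
  apply: (@closed_comp _ _ (@enorm R n) [set a | a <= L]) => [c _|]; last exact: closed_le.
  exact: continuous_enorm.
have convK a b t : K a -> K b -> 0 <= t <= 1 -> K (a + t *: (b - a)).
  move=> [a1 a2] [b1 b2] t01; split; first exact: clarke_subdiff_convex.
  have /andP[t0 t1] := t01.
  have -> : a + t *: (b - a) = (1 - t) *: a + t *: b.
    by rewrite scalerBr scalerBl scale1r addrAC addrA.
  apply: le_trans (enormD _ _) _; rewrite !enormZ !ger0_norm ?subr_ge0//.
  have t1' : 0 <= 1 - t by rewrite subr_ge0.
  have := ler_wpM2l t1' a2; have := ler_wpM2l t0 b2; lra.
have [g' Kg' hg'] := compact_convex_proj g K0 cK convK.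
have le : enorm (g - g') <= eps.
  have eps0 : 0 <= eps.
    rewrite /eps !mulr_ge0 ?addr_ge0 ?divr_ge0 ?sqrtr_ge0 ?(ltW L0) ?(ltW Lhat0)//.
  (* The Clarke inequality is tested in the direction [g - g'], in which [g'] dominates [K]; the
     arbitrary [e] is then removed. *)
  have h : enorm (g - g') ^+ 2 <= eps * enorm (g - g').
    rewrite sqr_enorm dotvBl lerBlDl; apply/ler_addgt0Pr => e e0.
    by apply: (clarke_subdiff_le dg); exact: VNmax_quotient.
  have [->//|/negPf v0] := eqVneq (enorm (g - g')) 0.
  by move: h; rewrite expr2 ler_pM2r// lt_def v0 enorm_ge0.
(* Since [g + xi = 0], the element [g' + xi] of the stationarity map has norm [enorm (g - g')]. *)
apply: (@le_trans _ _ (enorm (0 - (g' + xi)))%:E).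
  apply: ereal_inf_lbound; exists (g' + xi) => //.
  by exists g'; [exact: Kg'.1|exists xi].
rewrite lee_fin; apply: le_trans le; rewrite -gxi opprD addrACA subrr addr0.
by rewrite lexx.
Qed.

End Residual.

End MinimaxStationarity.

Unset Implicit Arguments.
Set Strict Implicit.

Theorem proposition2 (R : realType) (n m : nat)
    (X : set 'rV[R]_n) (Y : set 'rV[R]_m) (f : 'rV[R]_(n + m) -> R)
    (L L0 Lhat : R)
    (d : measure_display) (Omega : measurableType d) (Pr : probability Omega R)
    (P : probability (borel_rV R m) R) (y : nat -> {RV Pr >-> borel_rV R m})
    (C0 gamma delta0 : R) (kappa_p : 'rV[R]_n -> R) :
  X !=set0 -> compact X -> convex_set X ->
  Y !=set0 -> compact Y -> convex_set Y ->
  0 < L -> 0 < L0 -> L < Lhat ->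
  smoothness_assumption X Y f L L0 ->
  P Y = 1%E -> iid P y -> lower_mass Y P C0 gamma delta0 ->
  PL_condition X Y f kappa_p ->
  forall (N : nat) (w : Omega), (0 < N)%N ->
  (forall j, (j < N)%N -> Y (y j w)) ->
  let s := fun j => y j w in
  let V := Vmax Y f in
  let VN := VNmax Y f Lhat N s in
  let beta := betaN Y N s in
  let Lk := Lkappa Y kappa_p L L0 Lhat in
  let D := stationary X V in
  let DN := stationary X VN in
  D !=set0 -> DN !=set0 ->
  (forall xN, DN xN ->
     (dist xN D <= eb_modulus_inv X V D (Lk xN * beta)%:E)%E) /\
  (excess DN D <=
     eb_modulus_inv X V D (ereal_sup [set (Lk x * beta)%:E | x in DN]))%E.
Proof.
move=> _ _ _ Y0 cY convY Lgt0 L0gt0 LLhat [[U oU [XYU f2]] glip _ gbd] _ _ _ PL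
  N w N0 sY s V VN beta Lk D DN Dn0 _.
have b0 : 0 <= beta by exact: betaN_ge0.
have res x : DN x -> X x /\ (residual X V x <= (Lk x * beta)%:E)%E.
  move=> DNx; have Xx : X x by case: DNx.
  split => //; have [k0 PLx] := PL x Xx.
  (* The PL condition bounds a squared distance to a set; each normal vector gives an element of
     that set, hence a real inequality. *)
  have PL' y' xi : Y y' -> normal_cone Y y' xi ->
      kappa_p x * (Vmax Y f x - f (row_mx x y')) <= enorm (- grad_y f x y' + xi) ^+ 2.
    move=> Yy' nxi; rewrite -lee_fin; apply: le_trans (PLx _ Yy') _.
    rewrite EFin_expe lee_sqr ?dist_ge0 ?lee_fin ?enorm_ge0//.
    apply: ereal_inf_lbound; exists (- grad_y f x y' + xi); last by rewrite sub0r enormN.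
    by exists (- grad_y f x y') => //; exists xi.
  have := residual_le Y0 cY convY Lgt0 LLhat oU XYU f2 glip gbd N0 sY Xx k0 PL' DNx.
  move=> /le_trans; apply; rewrite lee_fin /Lk /Lkappa mulrA ler_wpM2r//.
  rewrite ler_wpM2r ?sqrtr_ge0// lerDr mulr_ge0 ?(ltW L0gt0)//.
  exact: diameter_ge0.
split=> [x DNx|].
  by have [Xx rx] := res x DNx; exact: dist_le_eb_modulus_inv.
apply: ge_ereal_sup => _ [x DNx <-]; have [Xx rx] := res x DNx.
(* Monotonicity of the inverse modulus passes from the single point to the supremum. *)
apply: le_trans (dist_le_eb_modulus_inv Dn0 Xx rx) _.
by apply: eb_modulus_inv_le; apply: ereal_sup_ubound; exists x.
Qed.
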